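(* Let $X\subset\mathbb{R}$ and $Y\subset\mathbb{R}$ be compact intervals, $X$ being the closure of its interior, and let $f:X\to Y$ be measurable with finite total variation $V(f)<+\infty$. Let $\mu$, $\mu_0$, $m$, $m_0$, $\delta_0$, and $f_{\beta,d}$ be as in the context, and put $\beta_d:=2^{3-\sqrt d}$. Then for any real $r>2$ and any integer $d>1$, $$\|f-f_{\beta_d,d}\|_{L^1(X)}\le \mathrm{vol}(X)\left(\frac{2\delta_0}{\sqrt d-1}+d^{-1/4}\right)+\mathrm{diam}(Y)\left(\frac{8(m+m_0)(3r)^{2r}e^{4/d}}{4\,e^{2r-2}\,d^{\,r-2}}+\frac{4\,d^{1/4}\,V(f)\,\delta_0}{\sqrt d-1}\right).$$
   Context: The total variation is $V(f)=\sup_{n\in\mathbb{N}}\sup_{x_0<x_1<\dots<x_n}\sum_{i=1}^n|f(x_i)-f(x_{i-1})|$, the points $x_i$ ranging over $X$. Here $p=2$. $\mu$ is the Borel measure on $\mathbb{R}^2$ supported on the graph of $f$, $d\mu(x,y)=\mathbb{I}_X(x)\,dx\,\delta_{f(x)}(dy)$, i.e. $\mu(A)=\mathrm{vol}(\{x\in X:(x,f(x))\in A\})$. Write $\mathbf{z}=(x,y)\in\mathbb{R}^2$ and $n_d=\binom{2+d}{d}$. The reference measure $\mu_0$ is a positive Borel measure on $\mathbb{R}^2$, absolutely continuous with respect to Lebesgue measure, with compact support. For each $d$, $\mathbf{b}=(b_1,\dots,b_{n_d})^\top$ is a vector of polynomials in $\mathbf{z}$ of total degree at most $d$ that is orthonormal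 for $\mu_0$: $\int b_ib_j\,d\mu_0=1$ if $i=j$ and $0$ otherwise. The moment matrix is $\mathbf{M}_{\mu,d}=\int \mathbf{b}(\mathbf{z})\mathbf{b}(\mathbf{z})^\top d\mu(\mathbf{z})$. For $\beta>0$ the regularized Christoffel-Darboux polynomial is $$q_{\mu+\beta\mu_0,d}(\mathbf{z})=\mathbf{b}(\mathbf{z})^\top(\mathbf{M}_{\mu,d}+\beta \mathbf{I}_{n_d})^{-1}\mathbf{b}(\mathbf{z}).$$ The semi-algebraic approximant is $f_{\beta,d}(x):=\min\{\mathrm{argmin}_{y\in Y}\,q_{\mu+\beta\mu_0,d}(x,y)\}$ for $x\in X$ (the smallest minimizer). Constants: $\delta_0:=\mathrm{diam}(\mathrm{supp}(\mu+\mu_0))$, $m:=\mu(\mathbb{R}^2)$, $m_0:=\mu_0(\mathbb{R}^2)$. The support of a positive Borel measure is the smallest closed set whose complement has measure zero; $\mathrm{vol}$ is Lebesgue measure; $\mathrm{diam}$ is Euclidean diameter. *)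

(* Defs.v *)
From HB Require Import structures.
From mathcomp Require Import all_boot all_order all_algebra.
(* The notations of mpoly clash with those of MathComp-Analysis; [mpoly n R]
   below is the type of polynomials in n variables over R, and [msize p] is the
   total degree of p plus one (0 for p = 0).  mpoly is imported first because it also
   defines a name isMeasure. *)
From mathcomp Require Import -(notations) mpoly.
From mathcomp Require Import all_classical all_reals all_analysis.

Set Implicit Arguments.
Unset Strict Implicit.
Unset Printing Implicit Defensive.

Import Order.TTheory GRing.Theory Num.Theory.
Import numFieldNormedType.Exports.

Local Open Scope classical_set_scope.
Local Open Scope ring_scope.

(* R^2 with the sigma-algebra on which [lebesgue_measure \x lebesgue_measure]
   is defined; as a type it is convertible to R * R. *)
Definition plane (R : realType) : measurableType _ :=
  (measurableTypeR R * measurableTypeR R)%type.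

Section graph_measure.
Context {R : realType} (X : set R) (mX : measurable X).
Context (f : R -> R) (mf : measurable_fun X f).

(* The proofs mX and mf are not used by the set function itself; they are kept
   as arguments so that it can be given its canonical structure of measure. *)
Definition graph_measure of measurable X & measurable_fun X f :=
  fun A : set (plane R) => lebesgue_measure [set x | X x /\ A (x, f x)].

Local Notation gm := (graph_measure mX mf).

Let measurable_graph_preimage (A : set (plane R)) : measurable A ->
  @measurable _ (measurableTypeR R) [set x | X x /\ A (x, f x)].
Proof.
move=> mA.
have mfX : @measurable_fun _ _ (measurableTypeR R) (measurableTypeR R)
    setT (f \_ X) by exact/(measurable_restrictT f mX).
have mg := measurable_fun_pair (@measurable_id _ (measurableTypeR R) setT) mfX.
rewrite (_ : [set x | _] = X `&` (fun x => (x, (f \_ X) x)) @^-1` A); last first.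
  by apply/seteqP; split=> x /= [Xx]; rewrite patchE mem_set.
by apply: measurableI => //; rewrite -[_ @^-1` _]setTI; exact: mg.
Qed.

Let graph_measure0 : gm set0 = 0%E.
Proof.
rewrite /graph_measure (_ : [set x | _] = set0) ?measure0//.
by rewrite -subset0 => x [].
Qed.

Let graph_measure_ge0 A : (0 <= gm A)%E.
Proof. exact: measure_ge0. Qed.

Let graph_measure_sigma_additive : semi_sigma_additive gm.
Proof.
move=> F mF tF mUF.
have -> : gm (\bigcup_n F n) =
    lebesgue_measure (\bigcup_n [set x | X x /\ F n (x, f x)]).
  rewrite /graph_measure; congr lebesgue_measure.
  rewrite eqEsubset; split=> [x [Xx [n _ Fn]]|x [n _ [Xx Fn]]].
    by exists n.
  by split=> //; exists n.
apply: measure_semi_sigma_additive.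
- by move=> n; exact: measurable_graph_preimage.
- move=> i j _ _ [x [[_ Fi] [_ Fj]]]; apply: tF => //.
  by exists (x, f x).
- by apply: bigcup_measurable => n _; exact: measurable_graph_preimage.
Qed.

HB.instance Definition _ := isMeasure.Build _ _ _ gm
  graph_measure0 graph_measure_ge0 graph_measure_sigma_additive.

End graph_measure.

Definition measure_support {R : realType} (nu : set (plane R) -> \bar R) :
    set (R * R) :=
  \bigcap_(F in [set F : set (R * R) | closed F /\ nu (~` F) = 0%E]) F.

(* The norm of MathComp-Analysis on R * R is the max norm, hence an explicit
   Euclidean distance. *)
Definition euclidean_dist {R : realType} (z w : R * R) : R :=
  Num.sqrt ((z.1 - w.1) ^+ 2 + (z.2 - w.2) ^+ 2).

Definition diameter {R : realType} {T : Type} (dist : T -> T -> R)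
    (A : set T) : R :=
  sup [set dist z w | z in A & w in A].

Definition eval2 {R : realType} (p : mpoly 2 R) (z : R * R) : R :=
  meval (fun i : 'I_2 => if i == 0 then z.1 else z.2) p.

(* The case i = j puts every b i in L^2(mu0), so the products are integrable;
   as the b i then form a basis of the polynomials of total degree <= d, the
   constant 1 is in L^2(mu0), i.e. mu0 is finite. *)
Definition orthonormal_polys {R : realType}
    (mu0 : {measure set (plane R) -> \bar R})
    (d : nat) (b : 'I_('C(2 + d, d)) -> mpoly 2 R) : Prop :=
  (forall i, (msize (b i) <= d.+1)%N) /\
  (forall i j, (\int[mu0]_z (eval2 (b i) z * eval2 (b j) z)%:E
                = ((i == j)%:R)%:E)%E).

Definition moment_mx {R : realType} (mu : {measure set (plane R) -> \bar R})
    (n : nat) (b : 'I_n -> mpoly 2 R) : 'M[R]_n :=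
  \matrix_(i, j) \int[mu]_z (eval2 (b i) z * eval2 (b j) z).

(* q_{mu + beta mu0, d}; mu0 enters only through the choice of b. *)
Definition cd_poly {R : realType} (mu : {measure set (plane R) -> \bar R})
    (n : nat) (b : 'I_n -> mpoly 2 R) (beta : R) (z : R * R) : R :=
  let bz : 'cV[R]_n := \col_i eval2 (b i) z in
  (bz^T *m invmx (moment_mx mu b + beta%:M) *m bz) ord0 ord0.

Definition argmin {R : realType} {T : Type} (Y : set T) (g : T -> R) : set T :=
  [set y | Y y /\ forall y', Y y' -> g y <= g y'].

(* The least element of A, when there is one. *)
Definition set_min {R : realType} (A : set R) : R := get (A `&` lbound A).

Definition cd_approx {R : realType} (mu : {measure set (plane R) -> \bar R})
    (n : nat) (b : 'I_n -> mpoly 2 R) (beta : R) (Y : set R) (x : R) : R :=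
  set_min (argmin Y (fun y => cd_poly mu b beta (x, y))).

(* Main.v *)
Require Import Defs.
From mathcomp Require Import all_boot all_order all_algebra.
From mathcomp Require Import -(notations) mpoly.
From mathcomp Require Import all_classical all_reals all_analysis.
From mathcomp Require Import measurable_realfun ring lra.
Import Order.TTheory GRing.Theory Num.Theory.
Import numFieldNormedType.Exports.
Local Open Scope classical_set_scope.
Local Open Scope ring_scope.

Set Implicit Arguments.
Unset Strict Implicit.
Unset Printing Implicit Defensive.

(** A point z is detected by the value of q = q_{mu + beta mu0, d}: for a
polynomial p of degree at most d with p(z) = 1,

  1 / q(z) <= int p^2 dmu + beta int p^2 dmu0            (Cauchy-Schwarz),

while int q dmu is at most the number n_d of basis polynomials, because
q = b^T (M + beta I)^-1 b integrates to tr ((M + beta I)^-1 M).  So q is small on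
most of the graph of f, and large away from it as soon as a good p exists.

- Away from the graph ([cd_poly_lower_bound_off_graph]).  Let z lie at distance
  D' from the graph, with D' not too small against the diameter delta0 of the
  support K of mu + mu0.  All of K lies within rho = D' + delta0 of z, and mu is
  carried by the shell between the radii D' and rho.  A quadratic function of the
  distance to z maps this shell into [0, 1] and z to 1 + (D'/rho)^2.  Composing it
  with a Chebyshev polynomial T_k, where k is the integer part of d/2, gives after
  normalization at z a needle: it is bounded by 1 within rho of z, and its square
  is at most beta = 2^(3 - sqrt d) on the shell ([needle_polynomial]).  Hence
  q(z) >= 1 / (beta (m + m0)).
- On the graph ([graph_markov]).  Markov's inequality bounds the measure of the
  set B1 of those x with q(x, f(x)) >= 1 / (beta (m + m0)) by
  beta (m + m0) n_d; an elementary estimate of t^(2r) 2^(-t) turns this into the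
  first term of the factor of diam Y ([markov_rate]).
- Bounded variation ([small_oscillation_off_small_set]).  Off a set B2 of measure
  at most 3 V D / eps, f moves by at most eps on the D-neighbourhood of x.

For x outside B1 and B2 the minimizer y satisfies q(x, y) <= q(x, f(x)), which is
below the threshold, so (x, y) is within D of some (x', f(x')) and
|f(x) - y| <= D + eps; on B1 and B2 the error is at most diam Y.  The theorem is
the case eps = d^(-1/4), D = (4/3) delta0 / (sqrt d - 1): this D makes the
oscillation term exactly 4 V delta0 d^(1/4) / (sqrt d - 1), and it keeps
D / (D + delta0) = 4 / (3 sqrt d + 1) large enough for the needle. *)

(** * Polynomials in the plane *)

Lemma eval2E (R : realType) (p : mpoly 2 R) (z : R * R) :
  eval2 p z = \sum_(m <- msupp p) mcoeff m p * (z.1 ^+ m ord0 * z.2 ^+ m (lift ord0 ord0)).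
Proof.
rewrite /eval2 mevalE; apply: eq_bigr => m _.
by rewrite !big_ord_recl big_ord0 mulr1.
Qed.

Lemma eval2_sum (R : realType) n (u : 'I_n -> R) (B : 'I_n -> mpoly 2 R) z :
  eval2 (\sum_i u i *: B i) z = \sum_i u i * eval2 (B i) z.
Proof. by rewrite /eval2 raddf_sum/=; apply: eq_bigr => i _; rewrite mevalZ. Qed.

Lemma measurable_eval2 (R : realType) (p : mpoly 2 R) :
  measurable_fun setT (eval2 p : plane R -> R).
Proof.
rewrite (_ : eval2 p = fun z : plane R => \sum_(m <- msupp p)
    mcoeff m p * (z.1 ^+ m ord0 * z.2 ^+ m (lift ord0 ord0))).
  apply: measurable_sum => m; apply: measurable_funM => //.
  apply: measurable_funM; apply: measurable_funX.
    exact: measurable_fst.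
  exact: measurable_snd.
by apply/funext => z; rewrite eval2E.
Qed.

Lemma continuous_eval2 (R : realType) (p : mpoly 2 R) (x : R) :
  continuous (fun y => eval2 p (x, y)).
Proof.
pose P : {poly R} := \sum_(m <- msupp p)
   (mcoeff m p * x ^+ m ord0)%:P * 'X^(m (lift ord0 ord0)).
rewrite (_ : (fun y => _) = horner P); first exact: continuous_horner.
apply/funext => y; rewrite eval2E /P horner_sum; apply: eq_bigr => m _.
by rewrite hornerM hornerC hornerXn mulrA.
Qed.

Lemma eval2_bounded (R : realType) (p : mpoly 2 R) (C : R) :
  exists M, forall z, `|z.1| <= C -> `|z.2| <= C -> `|eval2 p z| <= M.
Proof.
exists (\sum_(m <- msupp p) `|mcoeff m p| * (C ^+ m ord0 * C ^+ m (lift ord0 ord0))).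
move=> z z1 z2; rewrite eval2E; apply: le_trans (ler_norm_sum _ _ _) _.
apply: ler_sum => m _; rewrite normrM ler_wpM2l// normrM !normrX.
have C0 : 0 <= C by exact: le_trans z1.
by rewrite ler_pM ?exprn_ge0// lerXn2r ?nnegrE.
Qed.

Lemma msizeM_leq (F : fieldType) n (p q : mpoly n F) a b :
  (msize p <= a.+1)%N -> (msize q <= b.+1)%N -> (msize (p * q) <= (a + b).+1)%N.
Proof.
move=> pa qb; have [->|p0] := eqVneq p 0; first by rewrite mul0r msize0.
have [->|q0] := eqVneq q 0; first by rewrite mulr0 msize0.
rewrite msizeM// -ltnS prednK; last by rewrite addn_gt0 lt0n msize_poly_eq0 p0.
by rewrite -addnS -addSn leq_add.
Qed.

Lemma msizeD_leq (F : fieldType) n (p q : mpoly n F) a :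
  (msize p <= a)%N -> (msize q <= a)%N -> (msize (p + q) <= a)%N.
Proof. by move=> pa qb; apply: leq_trans (msizeD_le _ _) _; rewrite geq_max pa. Qed.

(** The monomial X^i Y^j with i + j <= d is coded by the weakly increasing
pair (i, i + j) of elements of {0, ..., d}. *)
Lemma card_bmultinom2 d : (#|{: bmultinom 2 d.+1}| <= 'C(2 + d, d))%N.
Proof.
have -> : 'C(2 + d, d) = 'C(2 + d, 2) by rewrite -bin_sub ?leq_addl// addnK.
rewrite -(card_sorted_tuples 2 d) -cardsT.
pose g (m : bmultinom 2 d.+1) : 2.-tuple 'I_d.+1 :=
  [tuple inord (bmnm m ord0); inord (bmnm m ord0 + bmnm m ord_max)].
have mle (m : bmultinom 2 d.+1) : (bmnm m ord0 + bmnm m ord_max < d.+1)%N.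
  have := bmdeg m; rewrite mdegE !big_ord_recl big_ord0 addn0.
  by rewrite (_ : lift ord0 ord0 = ord_max)//; exact: val_inj.
have mle0 (m : bmultinom 2 d.+1) : (bmnm m ord0 < d.+1)%N.
  exact: leq_ltn_trans (leq_addr _ _) (mle m).
rewrite -(@card_imset _ _ g) => [|m1 m2 /(congr1 val)/= [] /(congr1 val) + /(congr1 val)].
  apply: subset_leq_card; apply/fintype.subsetP => _ /imsetP[m _ ->].
  by rewrite inE /= !inordK// leq_addr.
rewrite /= !inordK// => e0 e1; apply/val_inj/mnmP => i.
have {}e1 : bmnm m1 ord_max = bmnm m2 ord_max.
  by move/eqP: e1; rewrite e0 eqn_add2l => /eqP.
case: i => [[|[|//]] hi]; last by rewrite (_ : Ordinal hi = ord_max) ?e1//; exact: val_inj.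
by rewrite (_ : Ordinal hi = ord0) ?e0//; exact: val_inj.
Qed.

(** The matrix of the coefficients of B has full row rank, because B is free,
and at most as many columns as rows, because there are at most C(2 + d, d)
monomials; so its rows generate every vector of coefficients. *)
Lemma free_polys_span (F : fieldType) d (B : 'I_('C(2 + d, d)) -> mpoly 2 F) :
  (forall i, (msize (B i) <= d.+1)%N) ->
  (forall u : 'rV_('C(2 + d, d)), \sum_i u ord0 i *: B i = 0 -> u = 0) ->
  forall p : mpoly 2 F, (msize p <= d.+1)%N ->
  exists u : 'rV_('C(2 + d, d)), p = \sum_i u ord0 i *: B i.
Proof.
move=> szB freeB p szp.
pose N := #|{: bmultinom 2 d.+1}|.
pose mon (j : 'I_N) : multinom 2 := bmnm (enum_val j).
pose row_of (q : mpoly 2 F) : 'rV[F]_N := \row_j mcoeff (mon j) q.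
have row_of_inj q : (msize q <= d.+1)%N -> row_of q = 0 -> q = 0.
  move=> szq /rowP q0; apply/mpolyP => m; rewrite mcoeff0.
  have [mm|mm] := ltnP (mdeg m) d.+1.
    have := q0 (enum_rank (BMultinom mm)).
    by rewrite !mxE /mon enum_rankK.
  by apply: memN_msupp_eq0; apply: msize_mdeg_ge; exact: leq_trans szq mm.
pose C : 'M[F]_('C(2 + d, d), N) := \matrix_(i, j) mcoeff (mon j) (B i).
have rowC (u : 'rV_('C(2 + d, d))) : u *m C = row_of (\sum_i u ord0 i *: B i).
  apply/rowP => j; rewrite !mxE raddf_sum/=; apply: eq_bigr => i _.
  by rewrite !mxE mcoeffZ.
have szsum (u : 'rV_('C(2 + d, d))) : (msize (\sum_i u ord0 i *: B i) <= d.+1)%N.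
  apply: (big_ind (fun q : mpoly 2 F => msize q <= d.+1)%N) => [|q1 q2 h1 h2|i _].
  - by rewrite msize0.
  - exact: msizeD_leq.
  - exact: leq_trans (msizeZ_le _ _) (szB i).
have rkC : \rank C = 'C(2 + d, d).
  suff: row_free C by move=> /eqP.
  rewrite -kermx_eq0; apply/eqP/row_matrixP => i.
  rewrite row0; apply: freeB; apply: row_of_inj => //.
  by rewrite -rowC -row_mul mulmx_ker row0.
have fullC : row_full C.
  rewrite /row_full eqn_leq rank_leq_col rkC; exact: card_bmultinom2.
have /submxP[u pu] := submx_full (row_of p) fullC.
exists u; apply/eqP; rewrite -subr_eq0; apply/eqP/row_of_inj.
  by apply: msizeD_leq; rewrite ?msizeN.
apply/rowP => j; have := congr1 (fun v : 'rV_N => v ord0 j) pu.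
by rewrite rowC !mxE mcoeffB => ->; rewrite subrr.
Qed.

(** * Chebyshev polynomials and needles *)

(** The pair (T_n(x), U_(n-1)(x)) of Chebyshev polynomials of the first and
second kind.  The recursion makes sense in any commutative ring: it is used both
for polynomials in the plane and for their values. *)
Fixpoint cheb {R : comNzRingType} (x : R) (n : nat) : R * R :=
  if n is k.+1 then
    (x * (cheb x k).1 + (x ^+ 2 - 1) * (cheb x k).2, (cheb x k).1 + x * (cheb x k).2)
  else (1, 0).

Lemma rmorph_cheb (R S : comNzRingType) (g : {rmorphism R -> S}) (x : R) n :
  (g (cheb x n).1 = (cheb (g x) n).1) * (g (cheb x n).2 = (cheb (g x) n).2).
Proof.
elim: n => [|n [IH1 IH2]] /=; first by rewrite rmorph1 rmorph0.
by rewrite !(rmorphD, rmorphM, rmorphB, rmorphN, rmorph1, rmorphXn) IH1 IH2.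
Qed.

(** This Pell equation is the algebraic substitute for cos^2 + sin^2 = 1.  It
bounds T_n by 1 on [-1, 1], and bounds U_(n-1) by T_n / sqrt (x^2 - 1) for
x > 1. *)
Lemma cheb_pell (R : comNzRingType) (x : R) n :
  (cheb x n).1 ^+ 2 - (x ^+ 2 - 1) * (cheb x n).2 ^+ 2 = 1.
Proof.
elim: n => [|n IH] /=; first by rewrite expr0n /= mulr0 subr0 expr1n.
by rewrite -[RHS]IH; ring.
Qed.

Lemma cheb_sqr_le1 (R : realDomainType) (x : R) n :
  x ^+ 2 <= 1 -> (cheb x n).1 ^+ 2 <= 1.
Proof.
move=> x1; have := cheb_pell x n; have := sqr_ge0 (cheb x n).2.
by nra.
Qed.

Lemma cheb_mono (R : realDomainType) (x y : R) n : 1 <= x -> x <= y ->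
  [/\ 0 <= (cheb x n).1, (cheb x n).1 <= (cheb y n).1,
      0 <= (cheb x n).2 & (cheb x n).2 <= (cheb y n).2].
Proof.
move=> x1 xy; have x0 : 0 <= x by lra.
have xx0 : 0 <= x ^+ 2 - 1 by nra.
have xy2 : x ^+ 2 - 1 <= y ^+ 2 - 1 by nra.
elim: n => [|n [t0 tt u0 uu]] /=; first by split; lra.
split.
- by rewrite addr_ge0 ?mulr_ge0.
- by rewrite lerD ?ler_pM.
- by rewrite addr_ge0 ?mulr_ge0.
- by rewrite lerD ?ler_pM.
Qed.

(** For x >= 1 and s = sqrt (x^2 - 1), T_n(x) + s U_(n-1)(x) = (x + s)^n.  If
x = 1 + t^2 then s >= t, and the induction with t in place of s still gives
T_n + t U_(n-1) >= (1 + t)^n; the factor 2 absorbs t U_(n-1) <= T_n. *)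
Lemma cheb_lower (R : realDomainType) (t : R) n : 0 <= t ->
  (1 + t) ^+ n <= 2 * (cheb (1 + t ^+ 2) n).1.
Proof.
move=> t0; set x := 1 + t ^+ 2.
have x1 : 1 <= x by rewrite /x lerDl sqr_ge0.
have [T0 _ U0 _] := @cheb_mono _ x x n x1 (lexx _).
have TU : t * (cheb x n).2 <= (cheb x n).1.
  rewrite -(@ler_pXn2r _ 2) ?nnegrE ?mulr_ge0//.
  have := cheb_pell x n; rewrite /x.
  have := sqr_ge0 (t * (cheb (1 + t ^+ 2) n).2).
  have := sqr_ge0 (t ^+ 2 * (cheb (1 + t ^+ 2) n).2).
  by nra.
suff : (1 + t) ^+ n <= (cheb x n).1 + t * (cheb x n).2 by lra.
clear TU T0 U0.
elim: n => [|n IH]; first by rewrite expr0 /= mulr0 addr0.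
have [T0 _ U0 _] := @cheb_mono _ x x n x1 (lexx _).
have := ler_wpM2l (addr_ge0 ler01 t0) IH; rewrite -exprS => /le_trans; apply.
rewrite /=; set T := (cheb x n).1 in T0 *; set U := (cheb x n).2 in U0 *.
have : 0 <= t ^+ 2 * T by rewrite mulr_ge0 ?sqr_ge0.
have : 0 <= (t ^+ 2 + t ^+ 4 + t ^+ 3) * U.
  by rewrite mulr_ge0// !addr_ge0// exprn_ge0.
by rewrite /x; nra.
Qed.

Lemma eval2_cheb (R : realType) (p : mpoly 2 R) k z :
  eval2 (cheb p k).1 z = (cheb (eval2 p z) k).1.
Proof. by rewrite /eval2 rmorph_cheb. Qed.

(** The map r |-> 1 + t^2 - (r / rho)^2 of the distance r to z0.  For
t = D' / rho it sends the shell D' <= r <= rho into [0, 1], where Chebyshev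
polynomials are bounded by 1, and z0 to the point 1 + t^2, where they are
large. *)
Definition needle_arg (R : realType) (z0 : R * R) (t rho : R) : mpoly 2 R :=
  mpolyC 2 (1 + t ^+ 2) - (rho ^- 2) *:
    ((mpolyX R (mnm1 ord0) - mpolyC 2 z0.1) ^+ 2 +
     (mpolyX R (mnm1 (lift ord0 ord0)) - mpolyC 2 z0.2) ^+ 2).

Lemma eval2_needle_arg (R : realType) (z0 z : R * R) (t rho : R) :
  eval2 (needle_arg z0 t rho) z = 1 + t ^+ 2 - (euclidean_dist z0 z / rho) ^+ 2.
Proof.
rewrite /eval2 /needle_arg mevalB mevalZ mevalD !rmorphXn/= !mevalB !mevalC !mevalXU/=.
rewrite /euclidean_dist exprMn sqr_sqrtr ?addr_ge0 ?sqr_ge0// exprVn mulrC.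
by rewrite -!(sqrrN (z0.1 - _)) -(sqrrN (z0.2 - _)) !opprB.
Qed.

(** The second component has degree e (k - 1) for k > 0.  The induction starts at
k = 1 in order to carry this sharper bound, without which (x^2 - 1) U_(k-1)
would have too large a degree. *)
Lemma msize_cheb (F : fieldType) n (p : mpoly n F) e k : (msize p <= e.+1)%N ->
  (msize (cheb p k).1 <= (e * k).+1)%N.
Proof.
move=> pe; have p2e : (msize (p ^+ 2 - 1) <= (e + e).+1)%N.
  apply: msizeD_leq; first by rewrite expr2 msizeM_leq.
  by rewrite msizeN msize1.
case: k => [|k]; first by rewrite /= msize1.
suff [] : (msize (cheb p k.+1).1 <= (e * k.+1).+1)%N /\
          (msize (cheb p k.+1).2 <= (e * k).+1)%N by [].
elim: k => [|k [IH1 IH2]].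
  by rewrite /= !mulr0 !addr0 mulr1 muln1 muln0 msize1.
rewrite -/(cheb p k.+1) [cheb p k.+2]/= -/(cheb p k.+1); split.
  apply: msizeD_leq; first by rewrite (mulnS e k.+1) msizeM_leq.
  by rewrite !mulnS addnA msizeM_leq.
by apply: msizeD_leq => //; rewrite mulnS msizeM_leq.
Qed.

Lemma msize_needle_arg (R : realType) (z0 : R * R) (t rho : R) :
  (msize (needle_arg z0 t rho) <= 3)%N.
Proof.
have lin (i : 'I_2) (c : R) : (msize (mpolyX R (mnm1 i) - mpolyC 2 c) <= 2)%N.
  apply: msizeD_leq; first by rewrite msizeX mdeg1.
  by rewrite msizeN msizeC; case: (c != 0).
apply: msizeD_leq; first by rewrite msizeC; case: (_ != 0).
rewrite msizeN; apply: leq_trans (msizeZ_le _ _) _.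
by apply: msizeD_leq; rewrite expr2 (@msizeM_leq _ _ _ _ 1 1).
Qed.

Lemma ln2_ge (R : realType) : 2 / 3 <= ln (2 : R).
Proof.
(* (14/15)^10 >= 1/2, while ln(14/15) <= - 1/15. *)
have h : ln (14 / 15 : R) <= - 15^-1.
  have -> : (14 / 15 : R) = 1 + - 15^-1 by field.
  by apply: le_ln1Dx; lra.
have : ln (2^-1 : R) <= ln ((14 / 15) ^+ 10).
  by rewrite ler_ln ?posrE//; lra.
by rewrite lnXn ?lnV ?posrE//; lra.
Qed.

Lemma ln2_le1 (R : realType) : ln (2 : R) <= 1.
Proof. by have := @le_ln1Dx R 1; rewrite -[1 + 1]/(2 : R); apply; lra. Qed.

(** In the needle, k is the integer part of d / 2 and t is the ratio of the two
radii.  The function t / (1 + t) increases, so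
ln (1 + t) >= t / (1 + t) >= 4 / (3 s + 5).  As 2 k >= d - 1 = s^2 - 1 and
4 (s + 1) >= 3 s + 5, it follows that (1 + t)^(2 k) >= e^(s - 1) >= 2^(s - 1). *)
Lemma needle_rate (R : realType) (d k : nat) (t : R) (s := Num.sqrt d%:R) :
  (1 < d)%N -> (d <= k.*2.+1)%N -> 4 / (3 * s + 1) <= t ->
  (2 / (1 + t) ^+ k) ^+ 2 <= 2 `^ (3 - s).
Proof.
move=> d1 dk st.
have s1 : 1 <= s by rewrite -(@sqrtr1 R) ler_wsqrtr// ler1n ltnW.
have ss : s ^+ 2 = d%:R by rewrite sqr_sqrtr.
set t0 := 4 / (3 * s + 1) in st.
have t00 : 0 < t0 by rewrite divr_gt0//; lra.
have t1 : 0 < 1 + t by lra.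
have lnt : 4 / (3 * s + 5) <= ln (1 + t).
  have -> : 4 / (3 * s + 5) = - (- (t0 / (1 + t0))).
    by rewrite /t0 opprK; field; rewrite !gt_eqF//; lra.
  have /le_ln1Dx : -1 < - (t0 / (1 + t0)) by rewrite ltrN2 ltr_pdivrMr; lra.
  have -> : 1 + - (t0 / (1 + t0)) = (1 + t0)^-1 by field; rewrite gt_eqF//; lra.
  rewrite lnV ?posrE; last by lra.
  have : ln (1 + t0) <= ln (1 + t) by rewrite ler_ln ?posrE//; lra.
  by lra.
have lnk : (s - 1) * ln 2 <= ln ((1 + t) ^+ k.*2).
  rewrite lnXn// -[X in _ <= X]mulr_natl.
  have h1 : s ^+ 2 - 1 <= (k.*2)%:R by rewrite ss lerBlDr natr1 ler_nat.
  have : (s - 1) * ln 2 <= (s ^+ 2 - 1) * (4 / (3 * s + 5)).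
    apply: (@le_trans _ _ (s - 1)); first by rewrite ler_piMr ?ln2_le1//; lra.
    rewrite mulrA ler_pdivlMr; last by lra.
    by nra.
  move=> /le_trans; apply; rewrite ler_pM ?subr_ge0 ?divr_ge0//; nra.
have pk : 2 `^ (s - 1) <= (1 + t) ^+ k.*2.
  by rewrite -ler_ln ?posrE ?exprn_gt0 ?powR_gt0// ln_powR.
rewrite (_ : 3 - s = 2 - (s - 1)); last by ring.
rewrite powRB ?pnatr_eq0 ?implybT// -[X in 2 `^ X / _]/(2%:R) powR_mulrn//.
rewrite expr_div_n -exprM muln2 ler_pM2l; last by rewrite exprn_gt0.
by rewrite lef_pV2 ?posrE ?exprn_gt0 ?powR_gt0.
Qed.

Lemma euclidean_dist_ge1 (R : realType) (z w : R * R) : `|z.1 - w.1| <= euclidean_dist z w.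
Proof. by rewrite /euclidean_dist -sqrtr_sqr ler_wsqrtr// lerDl sqr_ge0. Qed.

Lemma euclidean_dist_ge2 (R : realType) (z w : R * R) : `|z.2 - w.2| <= euclidean_dist z w.
Proof. by rewrite /euclidean_dist -sqrtr_sqr ler_wsqrtr// lerDr sqr_ge0. Qed.

Lemma euclidean_dist_ge0 (R : realType) (z w : R * R) : 0 <= euclidean_dist z w.
Proof. exact: sqrtr_ge0. Qed.

Lemma euclidean_dist_triangle (R : realType) (z w v : R * R) :
  euclidean_dist z v <= euclidean_dist z w + euclidean_dist w v.
Proof.
rewrite -(@ler_pXn2r _ 2) ?nnegrE ?addr_ge0 ?euclidean_dist_ge0//.
rewrite sqrrD /euclidean_dist !sqr_sqrtr ?addr_ge0 ?sqr_ge0//.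
set x1 := z.1 - w.1; set x2 := z.2 - w.2; set y1 := w.1 - v.1; set y2 := w.2 - v.2.
have -> : z.1 - v.1 = x1 + y1 by rewrite /x1 /y1; ring.
have -> : z.2 - v.2 = x2 + y2 by rewrite /x2 /y2; ring.
suff : x1 * y1 + x2 * y2 <= Num.sqrt (x1 ^+ 2 + x2 ^+ 2) * Num.sqrt (y1 ^+ 2 + y2 ^+ 2).
  by rewrite -mulr_natr; lra.
rewrite -sqrtrM ?addr_ge0 ?sqr_ge0//; apply: le_trans (ler_norm _) _.
rewrite -sqrtr_sqr ler_wsqrtr//.
have := sqr_ge0 (x1 * y2 - x2 * y1); lra.
Qed.

(** Boundedness is what makes the supremum in the definition of the diameter an
upper bound: the supremum of an unbounded set of reals is 0 by convention. *)
Lemma euclidean_dist_le_diameter (R : realType) (A : set (R * R)) (C : R) :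
  (forall z, A z -> `|z.1| <= C /\ `|z.2| <= C) ->
  forall z w, A z -> A w -> euclidean_dist z w <= diameter euclidean_dist A.
Proof.
move=> AC z w Az Aw; apply: ub_le_sup; last by exists z => //; exists w.
exists (C + C + (C + C)) => _ [u /AC[u1 u2]] [v /AC[v1 v2]] <-.
have tri : euclidean_dist u v <= `|u.1 - v.1| + `|u.2 - v.2|.
  rewrite -(@ler_pXn2r _ 2) ?nnegrE ?addr_ge0 ?euclidean_dist_ge0//.
  rewrite /euclidean_dist sqr_sqrtr ?addr_ge0 ?sqr_ge0//.
  rewrite -(real_normK (num_real (u.1 - v.1))) -(real_normK (num_real (u.2 - v.2))).
  by have := mulr_ge0 (normr_ge0 (u.1 - v.1)) (normr_ge0 (u.2 - v.2)); lra.
have := ler_normB u.1 v.1; have := ler_normB u.2 v.2; lra.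
Qed.

(** The needle is T_k(x(z)) / T_k(1 + t^2), where t = dist0 / rho, where
x(z) = 1 + t^2 - (|z - z0| / rho)^2, and where k is the integer part of d / 2
because x has degree 2.  Within rho of z0, x(z) lies in [0, 1 + t^2], where
|T_k| <= T_k(1 + t^2); on the shell it lies in [0, 1], where |T_k| <= 1, and the
quotient is controlled by the growth of T_k(1 + t^2). *)
Lemma needle_polynomial (R : realType) (z0 : R * R) (dist0 delta0 : R) (d : nat)
    (s := Num.sqrt d%:R) (rho := dist0 + delta0) :
  (1 < d)%N -> 0 < dist0 -> 0 <= delta0 -> 4 / (3 * s + 1) <= dist0 / rho ->
  exists p : mpoly 2 R, [/\ (msize p <= d.+1)%N, eval2 p z0 = 1,
    (forall z, euclidean_dist z0 z <= rho -> eval2 p z ^+ 2 <= 1) &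
    (forall z, dist0 <= euclidean_dist z0 z -> euclidean_dist z0 z <= rho ->
       eval2 p z ^+ 2 <= 2 `^ (3 - s))].
Proof.
move=> d1 dist0_gt0 delta0_ge0; set t := dist0 / rho => tge.
have rho0 : 0 < rho by rewrite ltr_wpDr.
have t0 : 0 <= t by rewrite divr_ge0 ?ltW.
pose k := d./2.
have dk : (d <= k.*2.+1)%N by rewrite -{1}(odd_double_half d); case: (odd d).
have kd : (2 * k <= d)%N by rewrite mul2n -{1}(odd_double_half d) leq_addl.
pose T (x : R) := (cheb x k).1; pose T0 := T (1 + t ^+ 2).
have x01 : 1 <= 1 + t ^+ 2 by rewrite lerDl sqr_ge0.
have T0_low : (1 + t) ^+ k <= 2 * T0 by exact: cheb_lower.
have T0_gt0 : 0 < T0.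
  by rewrite -(pmulr_rgt0 _ (ltr0n R 2)) (lt_le_trans _ T0_low)// exprn_gt0//; lra.
have T0_ge1 : 1 <= T0 ^+ 2.
  have := cheb_pell (1 + t ^+ 2) k; rewrite -/(T0) => h.
  rewrite -[X in X <= _]h lerBlDr lerDl mulr_ge0 ?sqr_ge0// subr_ge0.
  by rewrite expr_ge1// ltW// (lt_le_trans _ x01).
pose p := T0^-1 *: (cheb (needle_arg z0 t rho) k).1.
have pE z : eval2 p z ^+ 2 = T (1 + t ^+ 2 - (euclidean_dist z0 z / rho) ^+ 2) ^+ 2 / T0 ^+ 2.
  rewrite /eval2 mevalZ -/(eval2 _ _) eval2_cheb eval2_needle_arg exprMn exprVn.
  by rewrite mulrC.
have dist_rho z : euclidean_dist z0 z <= rho -> (euclidean_dist z0 z / rho) ^+ 2 <= 1.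
  move=> zrho; rewrite expr_le1// ?divr_ge0 ?euclidean_dist_ge0 ?(ltW rho0)//.
  by rewrite ler_pdivrMr// mul1r.
have small x : 0 <= x -> x <= 1 -> T x ^+ 2 <= 1.
  by move=> x0 x1; apply: cheb_sqr_le1; rewrite expr_le1.
exists p; split.
- apply: leq_trans (msizeZ_le _ _) _; apply: leq_trans (msize_cheb _ (msize_needle_arg _ _ _)) _.
  by rewrite ltnS.
- rewrite /p /eval2 mevalZ -/(eval2 _ _) eval2_cheb eval2_needle_arg.
  rewrite /euclidean_dist !subrr expr0n/= addr0 sqrtr0 mul0r expr0n/= subr0.
  by rewrite mulVf// gt_eqF.
- move=> z zrho; rewrite pE ler_pdivrMr ?exprn_gt0// mul1r.
  have := dist_rho z zrho; have := sqr_ge0 (euclidean_dist z0 z / rho).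
  set y := (_ / rho) ^+ 2 => y0 y1.
  have x0 : 0 <= 1 + t ^+ 2 - y by have := sqr_ge0 t; lra.
  have [x1|/ltW x1] := leP (1 + t ^+ 2 - y) 1.
    by apply: le_trans T0_ge1; exact: small.
  have xx : 1 + t ^+ 2 - y <= 1 + t ^+ 2 by lra.
  have [h1 h2 _ _] := cheb_mono k x1 xx.
  by rewrite lerXn2r// nnegrE ltW.
- move=> z zdist zrho; rewrite pE.
  apply: le_trans (needle_rate d1 dk tge).
  have ty : t ^+ 2 <= (euclidean_dist z0 z / rho) ^+ 2.
    have : t <= euclidean_dist z0 z / rho by rewrite ler_wpM2r// invr_ge0 ltW.
    by move=> tz; rewrite lerXn2r// nnegrE// (le_trans t0).
  have Tx : T (1 + t ^+ 2 - (euclidean_dist z0 z / rho) ^+ 2) ^+ 2 <= 1.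
    apply: small; last by lra.
    by have := dist_rho z zrho; have := sqr_ge0 t; lra.
  have T0V : T0^-1 <= 2 / (1 + t) ^+ k.
    have tk : 0 < (1 + t) ^+ k by rewrite exprn_gt0//; lra.
    by rewrite ler_pdivlMr// mulrC ler_pdivrMr.
  apply: (@le_trans _ _ (T0^-1 ^+ 2)).
    by rewrite exprVn ler_piMl// invr_ge0 ltW// exprn_gt0.
  by rewrite lerXn2r// nnegrE ?invr_ge0 ?(ltW T0_gt0)// divr_ge0// exprn_ge0//; lra.
Qed.

(** * Positive definite quadratic forms *)

Definition qform (R : pzRingType) n (A : 'M[R]_n) (u : 'cV[R]_n) : R :=
  (u^T *m A *m u) ord0 ord0.

Lemma qformE (R : comNzRingType) n (A : 'M[R]_n) u :
  qform A u = \sum_i \sum_j A i j * (u i ord0 * u j ord0).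
Proof.
rewrite /qform mxE exchange_big/=; apply: eq_bigr => j _.
rewrite mxE mulr_suml; apply: eq_bigr => i _.
by rewrite !mxE; ring.
Qed.

Definition posdef (R : numDomainType) n (A : 'M[R]_n) :=
  A^T = A /\ forall u : 'cV_n, u != 0 -> 0 < qform A u.

Section PositiveDefinite.
Context {R : realFieldType} {n : nat} (A : 'M[R]_n) (Apd : posdef A).

Lemma posdef_ge0 u : 0 <= qform A u.
Proof.
have [->|/Apd.2/ltW//] := eqVneq u 0.
by rewrite /qform mulmx0 mxE.
Qed.

Lemma posdef_unit : A \in unitmx.
Proof.
rewrite -row_free_unit -kermx_eq0; apply/eqP/row_matrixP => i; rewrite row0.
apply/eqP; apply: contraT => u0; set u := row i _ in u0.
have : 0 < qform A u^T.
  by apply: Apd.2; apply: contra_neq u0 => /(congr1 trmx); rewrite trmxK trmx0.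
by rewrite /qform trmxK /u -row_mul mulmx_ker row0 mul0mx mxE ltxx.
Qed.

Lemma qform_inv u : qform (invmx A) u = qform A (invmx A *m u).
Proof.
rewrite /qform trmx_mul trmx_inv Apd.1 -!mulmxA; congr (_ _ _).
by rewrite (mulmxA A) mulmxV ?posdef_unit// mul1mx.
Qed.

Lemma qform_inv_ge0 u : 0 <= qform (invmx A) u.
Proof. by rewrite qform_inv posdef_ge0. Qed.

(** Cauchy-Schwarz for the scalar product of A, applied to c and A^-1 u: their
product is c^T u = 1.  It suffices to use that the form is nonnegative at the
vector L^-1 c - A^-1 u. *)
Lemma qform_inv_lower_bound (c u : 'cV[R]_n) (L : R) : 0 < L ->
  (c^T *m u) ord0 ord0 = 1 -> qform A c <= L -> L^-1 <= qform (invmx A) u.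
Proof.
move=> L0 cu1 cL; rewrite qform_inv; set v := invmx A *m u.
have cAv : (c^T *m A *m v) ord0 ord0 = 1.
  by rewrite /v mulmxA -(mulmxA c^T) mulmxV ?posdef_unit// mulmx1.
have vAc : (v^T *m A *m c) ord0 ord0 = 1.
  by rewrite -{}cAv -[in LHS]Apd.1 -[in LHS](trmxK c) -!trmx_mul mxE mulmxA.
have := posdef_ge0 (L^-1 *: c - v).
suff -> : qform A (L^-1 *: c - v) = L^-1 ^+ 2 * qform A c - L^-1 * 2 + qform A v.
  have : L^-1 ^+ 2 * qform A c <= L^-1.
    apply: le_trans (ler_wpM2l (sqr_ge0 _) cL) _.
    by rewrite expr2 mulfVK// gt_eqF.
  by lra.
have cAvE : c^T *m A *m v = 1%:M by apply/matrixP => i j; rewrite !ord1 cAv mxE eqxx.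
have vAcE : v^T *m A *m c = 1%:M by apply/matrixP => i j; rewrite !ord1 vAc mxE eqxx.
rewrite /qform (_ : (_ - _)^T = L^-1 *: c^T - v^T); last by rewrite linearB linearZ.
rewrite !mulmxBl !mulmxBr -!scalemxAl -!scalemxAr cAvE vAcE.
move: (c^T *m A *m c) (v^T *m A *m v) => P Q; rewrite !mxE eqxx /=.
by ring.
Qed.

End PositiveDefinite.

Lemma posdef_add_scalar (R : realFieldType) n (M : 'M[R]_n) (beta : R) : 0 < beta ->
  M^T = M -> (forall u, 0 <= qform M u) -> posdef (M + beta%:M).
Proof.
move=> b0 Msym Mpsd; split; first by rewrite linearD/= Msym tr_scalar_mx.
move=> u u0.
have -> : qform (M + beta%:M) u = qform M u + beta * (u^T *m u) ord0 ord0.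
  rewrite /qform mulmxDr mulmxDl mul_mx_scalar -scalemxAl.
  by move: (u^T *m M *m u) (u^T *m u) => P Q; rewrite !mxE.
rewrite ltr_wpDl ?Mpsd// mulr_gt0// mxE.
have [i ui] : exists i, u i ord0 != 0.
  apply/existsP; apply: contraNT u0; rewrite negb_exists => /forallP u0.
  by apply/eqP/colP => i; have := u0 i; rewrite negbK mxE => /eqP.
rewrite (bigD1 i)//= ltr_wpDr ?sumr_ge0//.
  by move=> j _; rewrite mxE -expr2 sqr_ge0.
by rewrite mxE -expr2 exprn_even_gt0.
Qed.

(** (M + beta I)^-1 M = I - beta (M + beta I)^-1, and the inverse of a positive
definite matrix has nonnegative trace. *)
Lemma mxtrace_inv_mul_le (R : realFieldType) n (M : 'M[R]_n) (beta : R) : 0 < beta ->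
  M^T = M -> (forall u, 0 <= qform M u) ->
  \tr (invmx (M + beta%:M) *m M) <= n%:R.
Proof.
move=> b0 Msym Mpsd; have Apd := posdef_add_scalar b0 Msym Mpsd.
set A := M + beta%:M in Apd *.
have -> : invmx A *m M = 1%:M - beta *: invmx A.
  rewrite [X in _ *m X](_ : M = A - beta%:M); last by rewrite addrK.
  by rewrite mulmxBr mulVmx ?posdef_unit// mul_mx_scalar.
rewrite linearB/= linearZ/= mxtrace1 lerBlDr lerDl mulr_ge0 ?(ltW b0)//.
apply: sumr_ge0 => i _; have := qform_inv_ge0 Apd (delta_mx i ord0).
by rewrite /qform trmx_delta -rowE -colE !mxE.
Qed.

(** * Christoffel-Darboux polynomials *)

Lemma ae_le_cst_integral d (T : measurableType d) (R : realType)
    (nu : {measure set T -> \bar R}) (h : T -> R) (c : R) : measurable_fun setT h ->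
  (forall x, 0 <= h x) -> 0 <= c -> nu [set x | c < h x] = 0%E ->
  (\int[nu]_x (h x)%:E <= c%:E * nu setT)%E.
Proof.
move=> mh h0 c0 nuh; rewrite -integral_cst//; apply: ae_ge0_le_integral => //.
- by move=> x _; rewrite lee_fin.
- exact/measurable_EFinP.
- exists [set x | c < h x]; split=> //.
    rewrite -[X in measurable X]setTI (_ : [set x | _] = h @^-1` `]c, +oo[%classic).
      exact: mh.
    by apply/seteqP; split=> x /=; rewrite in_itv/= andbT.
  by move=> x /not_implyP[_ /negP]; rewrite lee_fin -ltNge.
Qed.

Lemma integral_lincomb d (T : measurableType d) (R : realType)
    (nu : {measure set T -> \bar R}) (I : finType) (c : I -> R) (h : I -> T -> R) :
  (forall i, nu.-integrable setT (EFin \o h i)) ->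
  (\int[nu]_x (\sum_i c i * h i x)%:E = (\sum_i c i * \int[nu]_x h i x)%:E)%E.
Proof.
move=> ih; under eq_integral do rewrite -sumEFin.
under eq_integral do under eq_bigr do rewrite EFinM.
rewrite integral_sum//; last by move=> i; apply: integrableZl => //; exact: ih.
rewrite -sumEFin; apply: eq_bigr => i _.
rewrite (integralZl measurableT (ih i)) [RHS]EFinM /Rintegral fineK//.
exact: integrable_fin_num (ih i).
Qed.

Section Gram.
Context {R : realType} (nu : {measure set (plane R) -> \bar R}) {n : nat}.
Context (b : 'I_n -> mpoly 2 R).
Context (intb : forall i j,
  nu.-integrable setT (fun z => (eval2 (b i) z * eval2 (b j) z)%:E)).

Lemma moment_mx_sym : (moment_mx nu b)^T = moment_mx nu b.
Proof.
by apply/matrixP => i j; rewrite !mxE; apply: eq_Rintegral => z _; rewrite mulrC.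
Qed.

Lemma integral_moment_mx (Q : 'M[R]_n) :
  (\int[nu]_z (\sum_i \sum_j Q i j * (eval2 (b i) z * eval2 (b j) z))%:E =
   (\sum_i \sum_j Q i j * moment_mx nu b i j)%:E)%E.
Proof.
under eq_integral do rewrite pair_bigA/=.
rewrite (@integral_lincomb _ _ _ nu _ (fun p : 'I_n * 'I_n => Q p.1 p.2)
   (fun p z => eval2 (b p.1) z * eval2 (b p.2) z))//; last by move=> p; exact: intb.
by rewrite pair_bigA/=; congr EFin; apply: eq_bigr => p _; rewrite mxE.
Qed.

(** The moment matrix is the Gram matrix of b in L^2(nu). *)
Lemma integral_sqr_eval2 (u : 'I_n -> R) :
  (\int[nu]_z (eval2 (\sum_i u i *: b i) z ^+ 2)%:E =
   (qform (moment_mx nu b) (\col_i u i))%:E)%E.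
Proof.
rewrite qformE (_ : \sum_i _ = \sum_i \sum_j
   (\matrix_(i, j) (u i * u j)) i j * moment_mx nu b i j); last first.
  by apply: eq_bigr => i _; apply: eq_bigr => j _; rewrite !mxE mulrC.
rewrite -integral_moment_mx; apply: eq_integral => z _; congr EFin.
rewrite eval2_sum expr2 mulr_suml; apply: eq_bigr => i _.
by rewrite mulr_sumr; apply: eq_bigr => j _; rewrite mxE; ring.
Qed.

Lemma qform_moment_mx_ge0 (u : 'cV[R]_n) : 0 <= qform (moment_mx nu b) u.
Proof.
have := integral_sqr_eval2 (fun i => u i ord0).
rewrite (_ : \col_i _ = u); last by apply/colP => i; rewrite mxE.
move=> /eqP; rewrite eq_le => /andP[+ _]; rewrite -lee_fin; apply: le_trans.
by apply: integral_ge0 => z _; rewrite lee_fin sqr_ge0.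
Qed.

Context (beta : R) (beta0 : 0 < beta).

Let A := moment_mx nu b + beta%:M.

Lemma moment_mx_reg_posdef : posdef A.
Proof.
exact: posdef_add_scalar beta0 moment_mx_sym qform_moment_mx_ge0.
Qed.

Lemma cd_polyE z : cd_poly nu b beta z = qform (invmx A) (\col_i eval2 (b i) z).
Proof. by []. Qed.

Lemma cd_poly_ge0 z : 0 <= cd_poly nu b beta z.
Proof. by rewrite cd_polyE qform_inv_ge0//; exact: moment_mx_reg_posdef. Qed.

(** Gives q the measurability and the continuity of polynomials. *)
Lemma cd_poly_eval2 : exists q : mpoly 2 R, cd_poly nu b beta = eval2 q.
Proof.
exists (\sum_i \sum_j invmx A i j *: (b i * b j)); apply/funext => z.
rewrite cd_polyE qformE /eval2 raddf_sum/=; apply: eq_bigr => i _.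
rewrite raddf_sum/=; apply: eq_bigr => j _.
by rewrite mevalZ mevalM !mxE.
Qed.

(** q integrates to the trace of (M + beta I)^-1 M. *)
Lemma integral_cd_poly_le : (\int[nu]_z (cd_poly nu b beta z)%:E <= n%:R%:E)%E.
Proof.
under eq_integral do rewrite cd_polyE qformE.
under eq_integral do under eq_bigr do under eq_bigr do rewrite 2!mxE.
rewrite integral_moment_mx lee_fin.
have := mxtrace_inv_mul_le beta0 moment_mx_sym qform_moment_mx_ge0.
apply: le_trans; rewrite /mxtrace; apply: ler_sum => i _.
rewrite [leRHS]mxE; apply: ler_sum => j _.
suff -> : moment_mx nu b j i = moment_mx nu b i j by [].
by rewrite -[in LHS]moment_mx_sym mxE.
Qed.

Lemma cd_poly_markov (K : R) : 0 < K ->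
  (nu [set z | (K <= cd_poly nu b beta z)%R] <= (n%:R / K)%:E)%E.
Proof.
move=> K0; have [q qE] := cd_poly_eval2.
have mq : measurable_fun setT (EFin \o cd_poly nu b beta : plane R -> \bar R).
  by rewrite qE; apply/measurable_EFinP; exact: measurable_eval2.
have := le_integral_abse nu measurableT mq K0.
rewrite (_ : _ `&` _ = [set z | K <= cd_poly nu b beta z]); last first.
  rewrite setTI; apply/seteqP; split=> z /=;
    by rewrite lee_fin ger0_norm// cd_poly_ge0.
under eq_integral do rewrite gee0_abs ?lee_fin ?cd_poly_ge0//.
move=> /le_trans/(_ integral_cd_poly_le).
by rewrite mulrC EFinM lee_pdivlMl.
Qed.

(** The left-hand side of the last hypothesis is u^T (M + beta I) u, that is
int p^2 dnu + beta |u|^2 for the polynomial p with coefficients u; if b is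
orthonormal for mu0, then |u|^2 = int p^2 dmu0. *)
Lemma cd_poly_lower_bound (u : 'I_n -> R) z0 (L : R) : 0 < L ->
  eval2 (\sum_i u i *: b i) z0 = 1 ->
  qform (moment_mx nu b) (\col_i u i) + beta * (\sum_i u i ^+ 2) <= L ->
  L^-1 <= cd_poly nu b beta z0.
Proof.
move=> L0 u1 uL; rewrite cd_polyE.
apply: (qform_inv_lower_bound moment_mx_reg_posdef L0 (c := \col_i u i)).
  rewrite mxE -[RHS]u1 eval2_sum; apply: eq_bigr => i _.
  by rewrite !mxE.
apply: le_trans uL; rewrite /qform mulmxDr mulmxDl mul_mx_scalar -scalemxAl.
rewrite mxE lerD2l mxE ler_pM2l// mxE ler_sum// => i _.
by rewrite !mxE expr2.
Qed.

End Gram.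

Section Orthonormal.
Context {R : realType} (mu0 : {measure set (plane R) -> \bar R}) {d : nat}.
Context (B : 'I_('C(2 + d, d)) -> mpoly 2 R).
Context (hB : orthonormal_polys mu0 B).

(** |x y| <= x^2 + y^2 reduces this to the squares, which have integral 1. *)
Lemma orthonormal_integrable i j :
  mu0.-integrable setT (fun z => (eval2 (B i) z * eval2 (B j) z)%:E).
Proof.
have meas p q : measurable_fun setT
    (fun z : plane R => (eval2 (B p) z * eval2 (B q) z)%:E).
  by apply/measurable_EFinP/measurable_funM; exact: measurable_eval2.
have sqr_int p : mu0.-integrable setT (fun z => (eval2 (B p) z * eval2 (B p) z)%:E).
  apply/integrableP; split=> //.
  under eq_integral do rewrite gee0_abs ?lee_fin -?expr2 ?sqr_ge0//.
  by have := hB.2 p p; under eq_integral do rewrite -expr2; move=> ->; rewrite ltry.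
apply: (@le_integrable _ _ _ mu0 setT measurableT _
    (fun z => (eval2 (B i) z * eval2 (B i) z)%:E + (eval2 (B j) z * eval2 (B j) z)%:E)%E) => //.
  move=> z _; rewrite -EFinD !abse_EFin lee_fin.
  set x := eval2 (B i) z; set y := eval2 (B j) z.
  rewrite [leRHS]ger0_norm -?expr2 ?addr_ge0 ?sqr_ge0//.
  rewrite ler_norml; have := sqr_ge0 (x + y); have := sqr_ge0 (x - y).
  have := sqr_ge0 x; have := sqr_ge0 y.
  by move=> *; apply/andP; split; nra.
exact: integrableD.
Qed.

Lemma orthonormal_moment_mx : moment_mx mu0 B = 1%:M.
Proof. by apply/matrixP => i j; rewrite !mxE /Rintegral hB.2. Qed.

Lemma orthonormal_integral_sqr (u : 'I_('C(2 + d, d)) -> R) :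
  (\int[mu0]_z (eval2 (\sum_i u i *: B i) z ^+ 2)%:E = (\sum_i u i ^+ 2)%:E)%E.
Proof.
rewrite integral_sqr_eval2; last exact: orthonormal_integrable.
rewrite orthonormal_moment_mx /qform mulmx1 mxE; congr EFin; apply: eq_bigr => i _.
by rewrite !mxE expr2.
Qed.

(** The identity |u|^2 = int (sum_i u_i b_i)^2 dmu0 shows that B is free, and B
has as many elements as there are monomials. *)
Lemma orthonormal_span (p : mpoly 2 R) : (msize p <= d.+1)%N ->
  exists u : 'I_('C(2 + d, d)) -> R, p = \sum_i u i *: B i.
Proof.
move=> szp.
have [|u ->] := free_polys_span hB.1 _ szp; last by exists (fun i => u ord0 i).
move=> u u0; apply/rowP => i; rewrite mxE.
have := orthonormal_integral_sqr (fun i => u ord0 i).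
rewrite u0; under eq_integral do rewrite /eval2 meval0 expr0n/=.
rewrite integral0 => -[] /esym/eqP; rewrite psumr_eq0 => [|j _]; last exact: sqr_ge0.
by move=> /allP/(_ i); rewrite mem_index_enum sqrf_eq0 => /(_ isT)/eqP.
Qed.

(** The constant 1 is in the span of B, hence square integrable. *)
Lemma orthonormal_finite : (mu0 setT < +oo)%E.
Proof.
have [|u u1] := @orthonormal_span 1; first by rewrite msize1.
have := orthonormal_integral_sqr u; rewrite -u1.
under eq_integral do rewrite /eval2 meval1 expr1n.
by rewrite integral_cst// mul1e => ->; rewrite ltry.
Qed.

End Orthonormal.

(** * Supports of measures on the plane *)

(** The boxes with rational corners, indexed by nat: a countable base of the
plane.  It makes open sets measurable for the product sigma-algebra, and reduces
unions of null open sets to countable unions. *)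
Definition rational_box (R : realType) (n : nat) : set (R * R) :=
  if unpickle n is Some (p, q, r, s) then
    `](ratr p : R), ratr q[%classic `*` `](ratr r : R), ratr s[%classic
  else set0.

Lemma measurable_rational_box (R : realType) n :
  measurable (@rational_box R n : set (plane R)).
Proof.
rewrite /rational_box; case: unpickle => [[[[p q] r] s]|]; last exact: measurable0.
by apply: measurableX.
Qed.

Lemma rational_box_basis (R : realType) (O : set (R * R)) z : open O -> O z ->
  exists2 n, rational_box n z & rational_box n `<=` O.
Proof.
move=> oO Oz; have /nbhs_ballP[e /= e0 eO] : nbhs z O by exact: open_nbhs_nbhs.
have ratbetween (x y : R) : x < y -> exists q : rat, x < ratr q < y.
  by move=> /rat_in_itvoo[q]; rewrite in_itv/= => h; exists q.
have [p /andP[p1 p2]] : exists q : rat, z.1 - e < ratr q < z.1 by apply: ratbetween; lra.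
have [q /andP[q1 q2]] : exists q : rat, z.1 < ratr q < z.1 + e by apply: ratbetween; lra.
have [r /andP[r1 r2]] : exists q : rat, z.2 - e < ratr q < z.2 by apply: ratbetween; lra.
have [s /andP[s1 s2]] : exists q : rat, z.2 < ratr q < z.2 + e by apply: ratbetween; lra.
exists (pickle (p, q, r, s)); rewrite /rational_box pickleK/=.
  by rewrite !in_itv/= p2 q1 r2 s1.
move=> w; rewrite /= !in_itv/= => -[/andP[w1 w2] /andP[w3 w4]].
by apply: eO; split; rewrite /= /ball/= ltr_norml; apply/andP; split; lra.
Qed.

Lemma open_plane_measurable (R : realType) (O : set (R * R)) :
  open O -> measurable (O : set (plane R)).
Proof.
move=> oO; rewrite (_ : O = \bigcup_(n in [set n | rational_box n `<=` O]) rational_box n).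
  by apply: bigcup_measurable => n _; exact: measurable_rational_box.
apply/seteqP; split=> [z Oz|z [n /= nO nz]]; last exact: nO.
by have [n nz nO] := rational_box_basis oO Oz; exists n.
Qed.

Lemma closed_plane_measurable (R : realType) (F : set (R * R)) :
  closed F -> measurable (F : set (plane R)).
Proof.
move=> cF; rewrite -[F]setCK; apply: measurableC.
by apply: open_plane_measurable; exact: closed_openC.
Qed.

Section Support.
Context {R : realType} (nu : {measure set (plane R) -> \bar R}).

Lemma measure_support_closed : closed (measure_support nu).
Proof. by apply: closed_bigI => F []. Qed.

Lemma measurable_measure_support : measurable (measure_support nu : set (plane R)).
Proof. exact: closed_plane_measurable measure_support_closed. Qed.

(** The complement of the support is the union of all null open sets.  It is also
the union of the null rational boxes, and these are countably many. *)
Lemma measure_support_null : nu (~` measure_support nu) = 0%E.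
Proof.
pose null n := nu (rational_box n) = 0%E.
have -> : ~` measure_support nu =
    \bigcup_n (if `[< null n >] then rational_box n else set0).
  apply/seteqP; split=> [z|z [n _]].
    move=> /existsNP[F /not_implyP[[cF nuF] Fz]].
    have [n nz nF] := rational_box_basis (closed_openC cF) Fz.
    exists n => //; case: asboolP => // /eqP; apply: contraNP => _.
    rewrite -measure_le0 -nuF le_measure// inE; first exact: measurable_rational_box.
    by apply: open_plane_measurable; exact: closed_openC.
  case: asboolP => // nulln nz /(_ (~` rational_box n)); apply => //.
  split; last by rewrite setCK.
  apply: open_closedC; rewrite /rational_box.
  case: unpickle => [[[[p q] r] s]|]; last exact: open0.
  pose A := `](ratr p : R), ratr q[%classic; pose B := `](ratr r : R), ratr s[%classic.
  change (open (((fst : R * R -> R) @^-1` A) `&` ((snd : R * R -> R) @^-1` B))).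
  apply: openI; apply: open_comp => [w _|].
  - exact: cvg_fst.
  - exact: interval_open.
  - exact: cvg_snd.
  - exact: interval_open.
apply: (@measure_negligible _ _ _ nu); last first.
  apply: negligible_bigcup => n; case: asboolP => [nulln|_]; last exact: negligible_set0.
  by apply/negligibleP => //; exact: measurable_rational_box.
apply: bigcup_measurable => n _; case: ifP => // _; exact: measurable_rational_box.
Qed.

Lemma measure_support_min (F : set (R * R)) :
  closed F -> nu (~` F) = 0%E -> measure_support nu `<=` F.
Proof. by move=> cF nuF z; apply. Qed.

End Support.

(** * Functions of bounded variation *)

Section BoundedVariation.
Context {R : realType} (a b : R) (f : R -> R).
Context (ab : a <= b).
Context (hV : (total_variation a b f < +oo)%E).

Let V := fine (total_variation a b f).
Let clamp (x : R) := Num.min b (Num.max a x).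
(** The variation function of f, extended by constants outside [a, b] so that the
cells adjacent to the ends of the interval need no separate treatment. *)
Let F (x : R) := fine (total_variation a (clamp x) f).

Let clamp_itv x : a <= clamp x <= b.
Proof. by rewrite /clamp le_min ab le_max lexx/= ge_min lexx. Qed.

Let TV_split u v : a <= u -> u <= v -> v <= b ->
  [/\ total_variation a u f \is a fin_num, total_variation u v f \is a fin_num,
     total_variation a v f = (total_variation a u f + total_variation u v f)%E,
     0 <= fine (total_variation u v f) &
     fine (total_variation a v f) <= V].
Proof.
move=> au uv vb; have av := le_trans au uv.
have e1 := total_variationD f au uv; have e2 := total_variationD f av vb.
have p1 := total_variation_ge0 f au; have p2 := total_variation_ge0 f uv.
have p3 := total_variation_ge0 f vb; have p4 := total_variation_ge0 f av.
have fv : total_variation a v f \is a fin_num.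
  by rewrite ge0_fin_numE//; apply: le_lt_trans hV; rewrite e2 leeDl.
split=> //.
- by rewrite ge0_fin_numE//; apply: le_lt_trans hV; rewrite e2 e1 -addeA leeDl// adde_ge0.
- by rewrite ge0_fin_numE//; apply: le_lt_trans hV; rewrite e2 e1 addeAC leeDr// adde_ge0.
- by rewrite fine_ge0.
- have fb : total_variation a b f \is a fin_num.
    by rewrite ge0_fin_numE// total_variation_ge0// (le_trans av vb).
  by apply: fine_le => //; rewrite e2 leeDl.
Qed.

Let F_ge0 x : 0 <= F x.
Proof. by have /andP[h _] := clamp_itv x; rewrite fine_ge0 ?total_variation_ge0. Qed.

Let F_le x : F x <= V.
Proof. by have /andP[h1 h2] := clamp_itv x; have [] := TV_split h1 (lexx _) h2. Qed.

Let F_homo : {homo F : x y / x <= y}.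
Proof.
move=> x y xy; have /andP[h1 _] := clamp_itv x; have /andP[_ h2] := clamp_itv y.
have h3 : clamp x <= clamp y.
  by rewrite /clamp le_min !ge_min lexx/= ge_max !le_max lexx xy !orbT.
have [h4 h5 e p _] := TV_split h1 h3 h2.
by rewrite /F e fineD// lerDl.
Qed.

Let F_osc u v : a <= u -> u <= v -> v <= b -> `|f v - f u| <= F v - F u.
Proof.
move=> au uv vb; have clampE z : a <= z -> z <= b -> clamp z = z.
  by move=> az zb; rewrite /clamp max_r// min_r.
rewrite /F !clampE ?(le_trans au uv) ?(le_trans uv vb)//.
have [h4 h5 e p _] := TV_split au uv vb.
rewrite e fineD// addrAC subrr add0r -lee_fin fineK//.
exact: total_variation_ge.
Qed.

(** Cut [a, b] into cells of length D, and call a cell bad if the variation of f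
over the cell and its two neighbours exceeds eps.  The points within D of a point
of a cell lie in these three cells, so f moves by at most eps there if the cell
is good.  Each cell belongs to three such blocks, so at most 3 V / eps cells are
bad. *)
Lemma small_oscillation_off_small_set (D eps : R) : 0 < D -> 0 < eps ->
  exists2 B : set R, measurable B &
    (lebesgue_measure B <= (3 * V * D / eps)%:E)%E /\
    forall x x', x \in `[a, b] -> x' \in `[a, b] -> ~ B x -> `|x - x'| <= D ->
      `|f x - f x'| <= eps.
Proof.
move=> D0 eps0.
pose N := (Num.truncn ((b - a) / D)).+1.
(* The block of cell k and its neighbours goes from a + (k - 1) D, where F takes
   the value G k, to a + (k + 2) D, where it takes the value G k.+3. *)
pose G (k : nat) := F (a + k%:R * D - D).
pose bad (k : nat) := eps < G k.+3 - G k.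
have leb_cell (k : nat) :
    lebesgue_measure (`[a + k%:R * D, a + k.+1%:R * D[%classic : set R) = D%:E.
  rewrite lebesgue_measure_itv/= lte_fin ltrD2l ltr_pM2r// ltr_nat ltnSn.
  by rewrite -EFinD -natr1 mulrDl mul1r; congr EFin; ring.
pose cell (k : nat) : set R := if bad k then `[a + k%:R * D, a + k.+1%:R * D[%classic else set0.
have mcell k : measurable (cell k) by rewrite /cell; case: ifP.
exists (\big[setU/set0]_(k < N) cell k); first exact: bigsetU_measurable.
split.
  apply: (le_trans (@Boole_inequality _ _ _ lebesgue_measure _ _ _)) => [i _|].
    exact: mcell.
  apply: (@le_trans _ _ (\sum_(k < N) (D / eps * (G k.+3 - G k))%:E)%E).
    apply: lee_sum => k _; rewrite /cell; case: ifPn => [bk|_].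
      apply: (@le_trans _ _ D%:E); first by have /eqP := leb_cell k; rewrite eq_le => /andP[].
      by rewrite lee_fin mulrAC -mulrA ler_peMr ?(ltW D0)// ler_pdivlMr// mul1r ltW.
    rewrite measure0 lee_fin mulr_ge0 ?divr_ge0 ?(ltW D0) ?(ltW eps0)// subr_ge0.
    by apply: F_homo; rewrite lerB// lerD2l ler_wpM2r ?(ltW D0)// ler_nat -addn3 leq_addr.
  rewrite sumEFin lee_fin -mulr_sumr.
  (* the variations over blocks of three cells form three telescoping sums *)
  have -> : \sum_(k < N) (G k.+3 - G k) =
     (G N.+2 - G 2%N) + (G N.+1 - G 1%N) + (G N - G 0%N).
    rewrite -(@telescope_sumr _ 0 N G)// -(@telescope_sumr _ 0 N (fun k => G k.+1))//.
    rewrite -(@telescope_sumr _ 0 N (fun k => G k.+2))// !big_mkord -!big_split/=.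
    by apply: eq_bigr => k _; ring.
  rewrite (_ : 3 * V * D / eps = D / eps * (3 * V)); last by ring.
  rewrite ler_wpM2l ?divr_ge0 ?(ltW D0) ?(ltW eps0)//.
  have lV k : G k <= V by exact: F_le.
  have g0 k : 0 <= G k by exact: F_ge0.
  have := lV N.+2; have := lV N.+1; have := lV N.
  by have := g0 0%N; have := g0 1%N; have := g0 2%N; lra.
move=> x x'; rewrite !in_itv/= => /andP[ax xb] /andP[ax' x'b] nB xx'.
pose k := Num.truncn ((x - a) / D).
have /andP[k1 k2] : k%:R * D <= x - a < k.+1%:R * D.
  rewrite -ler_pdivlMr// -ltr_pdivrMr//; apply: truncn_itv.
  by rewrite divr_ge0 ?subr_ge0 ?(ltW D0).
have kN : (k < N)%N.
  by rewrite ltnS /k; apply: le_truncn; rewrite ler_pM2r ?invr_gt0// lerB.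
have nbad : ~~ bad k.
  apply/negP => bk; apply: nB.
  rewrite -bigcup_mkord; exists k => //.
  by rewrite /cell bk /= in_itv/=; apply/andP; split; lra.
move: nbad; rewrite /bad -leNgt; apply: le_trans.
have e3 : k.+3%:R = k%:R + 3 :> R by rewrite -addn3 natrD.
have e1 : k.+1%:R = k%:R + 1 :> R by rewrite -addn1 natrD.
rewrite e1 in k2; move: xx'; rewrite ler_norml => /andP[x1 x2].
have [xlex'|/ltW x'lex] := leP x x'.
  rewrite distrC; apply: le_trans (F_osc ax xlex' x'b) _.
  by rewrite lerB// F_homo// ?e3; lra.
apply: le_trans (F_osc ax' x'lex xb) _.
by rewrite lerB// F_homo// ?e3; lra.
Qed.

End BoundedVariation.

(** * The measure carried by the graph *)

(** The minimizers form a nonempty compact set, so there is a least one. *)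
Lemma argmin_set_min (R : realType) (c e : R) (g : R -> R) : c <= e -> continuous g ->
  argmin `[c, e]%classic g (set_min (argmin `[c, e]%classic g)).
Proof.
move=> ce cg; have cgY : {within `[c, e], continuous g} by exact: continuous_subspaceT.
have [y0 y0Y y0min] := EVT_min ce cgY.
set A := argmin _ _; have AE : A = `[c, e]%classic `&` g @^-1` `]-oo, g y0]%classic.
  apply/seteqP; split=> y.
    by move=> [Yy ymin]; split=> //=; rewrite in_itv/= ymin.
  move=> [Yy /=]; rewrite in_itv/= => gy; split=> // y' Yy'.
  by apply: le_trans gy _; exact: y0min.
have cA : compact A.
  rewrite AE; apply: compact_closedI; first exact: segment_compact.
  by apply: closed_comp => // y _; exact: cg.
have A0 : A !=set0 by exists y0; rewrite AE; split=> //=; rewrite in_itv/= lexx.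
have idA : {within A, continuous (id : R -> R)} by apply: continuous_subspaceT => x; exact: cvg_id.
have [y yA ymin] := compact_EVT_min A0 cA idA.
have : exists y, (A `&` lbound A) y.
  by exists y; split; [exact: set_mem|move=> t At; apply: ymin; exact: mem_set].
by move=> /getPex[].
Qed.

Section GraphMeasure.
Context {R : realType} (a b c e : R) (ab : a < b) (f : R -> R).
Context (hfY : f @` `[a, b]%classic `<=` `[c, e]%classic).
Context (hf : measurable_fun `[a, b]%classic f).
Context (mu0 : {measure set (plane R) -> \bar R}).
Context (hcpt : compact (measure_support mu0)).

Let mu : {measure set (plane R) -> \bar R} := graph_measure (measurable_itv `[a, b]) hf.
Let K := measure_support (measure_add mu mu0).
Let delta0 := diameter euclidean_dist K.

Lemma graph_measureE A :
  mu A = lebesgue_measure [set x | `[a, b]%classic x /\ A (x, f x)].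
Proof. by []. Qed.

Lemma measurable_graph_preimage (A : set (plane R)) : measurable A ->
  measurable [set x | `[a, b]%classic x /\ A (x, f x)].
Proof.
move=> mA; set X := `[a, b]%classic.
have mX : measurable X by exact: measurable_itv.
have mfX : @measurable_fun _ _ (measurableTypeR R) (measurableTypeR R) setT (f \_ X).
  exact/(measurable_restrictT f mX).
have mg := measurable_fun_pair (@measurable_id _ (measurableTypeR R) setT) mfX.
rewrite (_ : [set x | _] = X `&` (fun x => (x, (f \_ X) x)) @^-1` A); last first.
  by apply/seteqP; split=> x /= [Xx]; rewrite patchE mem_set.
by apply: measurableI => //; rewrite -[_ @^-1` _]setTI; exact: mg.
Qed.

Lemma graph_measureT : mu setT = (b - a)%:E.
Proof.
rewrite graph_measureE (_ : [set x | _] = `[a, b]%classic).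
  by rewrite lebesgue_measure_itv/= lte_fin ab EFinD EFinN.
by apply/seteqP; split=> x //= [].
Qed.

Lemma graph_measure_null (A : set (plane R)) (N : set R) :
  measurable A -> measurable N -> lebesgue_measure N = 0%E ->
  (forall x, x \in `[a, b] -> A (x, f x) -> N x) -> mu A = 0%E.
Proof.
move=> mA mN N0 AN; rewrite graph_measureE; apply/eqP.
rewrite -measure_le0 -[X in (_ <= X)%E]N0; apply: le_measure.
- by rewrite inE; exact: measurable_graph_preimage.
- by rewrite inE.
- by move=> x /= [? ?]; exact: AN.
Qed.

(** A large closed box contains X x Y and the support of mu0, so its complement
is null for both measures, and it contains K. *)
Lemma graph_bounded : exists C, [/\ forall x, x \in `[a, b] -> `|x| <= C /\ `|f x| <= C &
  forall z, K z -> `|z.1| <= C /\ `|z.2| <= C].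
Proof.
have [M0 [_ hM0]] := @compact_bounded R _ _ hcpt.
pose M := `|M0| + 1.
have MM0 : M0 < M by rewrite /M (le_lt_trans (ler_norm _))// ltrDl.
have hM z : measure_support mu0 z -> `|z.1| <= M /\ `|z.2| <= M.
  by move=> /(hM0 _ MM0); rewrite /= ge_max => /andP[].
pose C := M + `|a| + `|b| + `|c| + `|e|.
have M_ge0 : 0 <= M by rewrite /M addr_ge0.
have CX x : x \in `[a, b] -> `|x| <= C /\ `|f x| <= C.
  move=> xab; have : `[c, e]%classic (f x) by apply: hfY; exists x.
  move: xab; rewrite /= !in_itv/= => /andP[ax xb] /andP[cx xe].
  have := ler_norm a; have := ler_norm (- a); have := ler_norm b; have := ler_norm (- b).
  have := ler_norm c; have := ler_norm (- c); have := ler_norm e; have := ler_norm (- e).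
  by rewrite !normrN /C !ler_norml => *; split; apply/andP; split; lra.
exists C; split=> // z.
pose F := [set z : R * R | `|z.1| <= C /\ `|z.2| <= C].
have cF : closed F.
  apply: (@closedI _ [set z : R * R | `|z.1| <= C] [set z : R * R | `|z.2| <= C]).
    apply: (@closed_comp _ _ (fun z : R * R => `|z.1|) [set x | x <= C]); last exact: closed_le.
    by move=> w _; apply: continuous_comp; [exact: cvg_fst|exact: norm_continuous].
  apply: (@closed_comp _ _ (fun z : R * R => `|z.2|) [set x | x <= C]); last exact: closed_le.
  by move=> w _; apply: continuous_comp; [exact: cvg_snd|exact: norm_continuous].
suff nuF : measure_add mu mu0 (~` F) = 0%E by exact: (measure_support_min cF nuF).
rewrite measure_addE.
have mCF : measurable (~` F : set (plane R)) by exact: measurableC (closed_plane_measurable cF).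
have muF : mu (~` F) = 0%E.
  by apply: (graph_measure_null mCF measurable0 (measure0 _)) => x /CX Fx; apply.
have mu0F : mu0 (~` F) = 0%E.
  apply/eqP; rewrite -measure_le0 -(measure_support_null mu0); apply: le_measure.
  - by rewrite inE.
  - by rewrite inE; exact: measurableC (measurable_measure_support mu0).
  move=> w nFw Kw; apply: nFw; have [w1 w2] := hM w Kw; rewrite /F /= /C.
  have := normr_ge0 a; have := normr_ge0 b; have := normr_ge0 c; have := normr_ge0 e.
  by move=> *; split; lra.
by rewrite muF mu0F add0e.
Qed.

Lemma dist_le_diameter z w : K z -> K w -> euclidean_dist z w <= delta0.
Proof.
by have [C [_ KC]] := graph_bounded; exact: euclidean_dist_le_diameter KC z w.
Qed.

Lemma measure_support_add_null : mu (~` K) = 0%E /\ mu0 (~` K) = 0%E.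
Proof.
have : measure_add mu mu0 (~` K) = 0%E by exact: measure_support_null.
rewrite measure_addE => /eqP; rewrite padde_eq0// => /andP[/eqP h1 /eqP h2].
by split.
Qed.

Lemma measurable_support_add : measurable (K : set (plane R)).
Proof. exact: measurable_measure_support. Qed.

(** The points of the graph outside K form a null set, while [a, b] has positive
measure. *)
Lemma graph_meets_support (P : set R) : measurable P -> lebesgue_measure P = 0%E ->
  exists x, [/\ x \in `[a, b], ~ P x & K (x, f x)].
Proof.
move=> mP P0; apply: contrapT => none.
have : mu setT = 0%E.
  apply: (@graph_measure_null _ (P `|` [set x | `[a, b]%classic x /\ (~` K) (x, f x)])).
  - exact: measurableT.
  - apply: measurableU => //; apply: measurable_graph_preimage.
    exact: measurableC measurable_support_add.
  - have mN := measurable_graph_preimage (measurableC measurable_support_add).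
    have N0 := measure_support_add_null.1; rewrite graph_measureE in N0.
    by apply/negligibleP => //; [exact: measurableU|apply: negligibleU; exact/negligibleP].
  - move=> x xab _; have [Px|nPx] := pselect (P x); first by left.
    by right; split=> // Kx; apply: none; exists x.
by rewrite graph_measureT => -[ba]; move: ab; rewrite -subr_gt0 ba ltxx.
Qed.

(** K contains two points of the graph with distinct abscissae. *)
Lemma diameter_gt0 : 0 < delta0.
Proof.
have [x [_ _ Kx]] := graph_meets_support measurable0 (measure0 _).
have [|y [_ yx Ky]] := @graph_meets_support [set x] _ (lebesgue_measure_set1 _).
  exact: measurable_set1.
apply: lt_le_trans (dist_le_diameter Kx Ky).
by apply: lt_le_trans (euclidean_dist_ge1 _ _); rewrite normr_gt0 subr_eq0; apply/eqP => /esym.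
Qed.

(** Polynomials are unbounded on the plane, but the set where one of them exceeds
its bound on the graph is null for mu. *)
Lemma graph_eval2_integrable (p : mpoly 2 R) : mu.-integrable setT (EFin \o eval2 p).
Proof.
have [C [CX _]] := graph_bounded.
have [M pM] := eval2_bounded p C.
have mp := measurable_eval2 p.
pose F : set (plane R) := [set z | `|eval2 p z| <= M].
have mF : measurable F.
  rewrite -[F]setTI (_ : F = (fun z => `|eval2 p z|) @^-1` `]-oo, M]%classic).
    by apply: (measurableT_comp _ mp) => //; exact: measurable_normr.
  by apply/seteqP; split=> z /=; rewrite in_itv.
apply/(@negligible_integrable _ _ _ mu setT (~` F)) => //.
- exact: measurableC.
- exact/measurable_EFinP.
- apply: (@graph_measure_null _ set0) => //; first exact: measurableC.
  by move=> x /CX[x1 x2]; apply; exact: pM.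
rewrite setTD setCK; apply: measurable_bounded_integrable => //.
- apply: (@le_lt_trans _ _ (mu setT)); last by rewrite graph_measureT ltry.
  by apply: le_measure; rewrite ?inE.
- exact: measurable_funTS.
- exists M; split; first exact: num_real.
  by move=> x Mx z; rewrite /F /= => h; exact: le_trans h (ltW Mx).
Qed.

Context (d : nat) (hd : (1 < d)%N) (B : 'I_('C(2 + d, d)) -> mpoly 2 R).
Context (hB : orthonormal_polys mu0 B).

Let m := b - a.
Let m0 := fine (mu0 setT).
Let s := Num.sqrt (d%:R : R).
Let beta := 2 `^ (3 - s).
Let q := cd_poly mu B beta.

Let beta_gt0 : 0 < beta. Proof. exact: powR_gt0. Qed.

Let m0_ge0 : 0 <= m0. Proof. exact: fine_ge0. Qed.

Let mu0TE : mu0 setT = m0%:E.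
Proof. by rewrite fineK// ge0_fin_numE// (orthonormal_finite hB). Qed.

Lemma graph_gram_integrable i j :
  mu.-integrable setT (fun z => (eval2 (B i) z * eval2 (B j) z)%:E).
Proof.
have := graph_eval2_integrable (B i * B j); congr (_.-integrable _ _).
by apply/funext => z; rewrite /= /eval2 mevalM.
Qed.

(** The needle is aimed at z0 with the inner radius D' equal to the distance from
z0 to the part of the graph that lies in K.  The triangle inequality through the
points of this part puts all of K within D' + delta0 of z0, wherever z0 is; and
the ratio D' / (D' + delta0) increases with D', so that it inherits the lower
bound assumed for D.  The needle p then satisfies int p^2 dmu <= beta m and
int p^2 dmu0 <= m0. *)
Lemma cd_poly_lower_bound_off_graph (z0 : R * R) (D : R) : 0 < D ->
  4 / (3 * s + 1) <= D / (D + delta0) ->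
  (forall x, x \in `[a, b] -> D <= euclidean_dist z0 (x, f x)) ->
  (beta * (m + m0))^-1 <= q z0.
Proof.
move=> D0 sD Dfar.
pose G := [set x | x \in `[a, b] /\ K (x, f x)].
pose E := [set euclidean_dist z0 (x, f x) | x in G].
have [x0 [x0ab _ Kx0]] := graph_meets_support measurable0 (measure0 _).
have E0 : E !=set0 by exists (euclidean_dist z0 (x0, f x0)); exists x0.
have Elb : has_lbound E by exists D => _ [x [xab _] <-]; exact: Dfar.
pose D' := inf E.
have DD' : D <= D' by apply: lb_le_inf => // _ [x [xab _] <-]; exact: Dfar.
have D'far x : x \in `[a, b] -> K (x, f x) -> D' <= euclidean_dist z0 (x, f x).
  by move=> xab Kx; apply: ge_inf => //; exists x.
have D'K w : K w -> euclidean_dist z0 w <= D' + delta0.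
  move=> Kw; rewrite -lerBlDr; apply: lb_le_inf => // _ [x [xab Kx] <-].
  rewrite lerBlDr; apply: le_trans (euclidean_dist_triangle _ (x, f x) _) _.
  by rewrite lerD2l; exact: dist_le_diameter.
have delta0_ge0 : 0 <= delta0 by exact/ltW/diameter_gt0.
have sD' : 4 / (3 * s + 1) <= D' / (D' + delta0).
  apply: le_trans sD _; rewrite ler_pdivrMr ?ltr_wpDr// mulrAC ler_pdivlMr; nra.
have [p [szp p1 pK pfar]] := needle_polynomial z0 hd (lt_le_trans D0 DD') delta0_ge0 sD'.
have [u pE] := orthonormal_span hB szp.
have mp2 : measurable_fun setT (fun z : plane R => eval2 p z ^+ 2).
  by apply: measurable_funX; exact: measurable_eval2.
have mgt (k : R) : measurable ([set z | k < eval2 p z ^+ 2] : set (plane R)).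
  rewrite -[X in measurable X]setTI.
  rewrite (_ : [set z | _] = (fun z => eval2 p z ^+ 2) @^-1` `]k, +oo[%classic).
    exact: mp2.
  by apply/seteqP; split=> z /=; rewrite in_itv/= andbT.
have [muK mu0K] := measure_support_add_null.
have mCK := measurableC measurable_support_add.
have h1 : qform (moment_mx mu B) (\col_i u i) <= beta * m.
  rewrite -lee_fin -(integral_sqr_eval2 graph_gram_integrable) -pE EFinM -graph_measureT.
  apply: ae_le_cst_integral => //; [by move=> z; exact: sqr_ge0|exact: ltW|].
  apply: (graph_measure_null (mgt _) (measurable_graph_preimage mCK)).
    by rewrite -graph_measureE.
  move=> x xab /= px; split=> // Kx.
  by have := pfar (x, f x) (D'far x xab Kx) (D'K _ Kx); rewrite leNgt px.
have h2 : \sum_i u i ^+ 2 <= m0.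
  rewrite -lee_fin -(orthonormal_integral_sqr hB) -pE -mu0TE -[leRHS]mul1e.
  apply: ae_le_cst_integral => //; [by move=> z; exact: sqr_ge0|].
  apply: (subset_measure0 (mgt _) mCK) => // z /= pz Kz.
  by have := pK z (D'K _ Kz); rewrite leNgt pz.
apply: (@cd_poly_lower_bound _ mu _ B graph_gram_integrable beta beta_gt0 u).
- by rewrite mulr_gt0// ltr_wpDr// subr_gt0.
- by rewrite -pE.
- by rewrite mulrDr lerD// ler_wpM2l// ltW.
Qed.

(** The threshold is the lower bound of q off the graph. *)
Lemma graph_markov :
  (lebesgue_measure [set x | `[a, b]%classic x /\ ((beta * (m + m0))^-1 <= q (x, f x))%R]
    <= (beta * (m + m0) * 'C(2 + d, d)%:R)%:E)%E.
Proof.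
have K0 : 0 < (beta * (m + m0))^-1 by rewrite invr_gt0 mulr_gt0// ltr_wpDr// subr_gt0.
have := cd_poly_markov graph_gram_integrable beta_gt0 K0.
by rewrite invrK => /le_trans; apply; rewrite lee_fin mulrC.
Qed.

Lemma measurable_graph_exceedance :
  measurable [set x | `[a, b]%classic x /\ ((beta * (m + m0))^-1 <= q (x, f x))%R].
Proof.
have [p pE] := @cd_poly_eval2 _ mu _ B beta.
suff mS : measurable ([set z | (beta * (m + m0))^-1 <= q z] : set (plane R)).
  exact: measurable_graph_preimage mS.
rewrite -[X in measurable X]setTI.
rewrite (_ : [set z | _] = q @^-1` `[(beta * (m + m0))^-1, +oo[%classic).
  by rewrite /q pE; apply: measurable_eval2.
by apply/seteqP; split=> z /=; rewrite in_itv/= andbT.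
Qed.

Lemma cd_approx_argmin x (hce : c <= e) :
  argmin `[c, e]%classic (fun y => q (x, y)) (cd_approx mu B beta `[c, e]%classic x).
Proof.
apply: argmin_set_min => //.
have [p pE] := @cd_poly_eval2 _ mu _ B beta.
by rewrite /q pE; exact: continuous_eval2.
Qed.

End GraphMeasure.

(** * The approximation error *)

(** Let s = sqrt d.  Since ln 2 >= 2 / 3, d^r 2^(-s) is at most
s^(2 r) e^(- 2 s / 3), whose maximum (3 r)^(2 r) e^(- 2 r) is attained at
s = 3 r.  The binomial coefficient is d^2 (1 + 1/d) (1 + 2/d) / 2, which is at
most d^2 e^(4/d) e^2 / 4. *)
Lemma markov_rate (R : realType) (r : R) (d : nat) (M : R) : 0 < r -> (0 < d)%N -> 0 <= M ->
  2 `^ (3 - Num.sqrt d%:R) * M * ('C(2 + d, d))%:R <=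
  8 * M * (3 * r) `^ (2 * r) * expR (4 / d%:R) / (4 * expR (2 * r - 2) * d%:R `^ (r - 2)).
Proof.
move=> r0 d0 M0.
set s := Num.sqrt d%:R.
have D0 : 0 < d%:R :> R by rewrite ltr0n.
have s0 : 0 < s by rewrite sqrtr_gt0.
have ss : s ^+ 2 = d%:R by rewrite sqr_sqrtr// ltW.
have two_s : 2 `^ (3 - s) <= 8 * expR (- (2 / 3 * s)).
  rewrite powRB ?pnatr_eq0 ?implybT// -[3]/(3%:R) powR_mulrn//.
  rewrite (_ : 2 ^+ 3 = 8); last by ring.
  rewrite expRN ler_pM2l// lef_pV2 ?posrE ?expR_gt0 ?powR_gt0//.
  rewrite /powR pnatr_eq0/= ler_expR mulrC ler_wpM2l ?ln2_ge//.
  exact: ltW.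
have dr : d%:R `^ r * expR (- (2 / 3 * s)) <= (3 * r) `^ (2 * r) * expR (- (2 * r)).
  have r3 : 0 < 3 * r by lra.
  rewrite /powR !gt_eqF//= -!expRD ler_expR -ss lnXn//.
  have : ln (1 + (s / (3 * r) - 1)) <= s / (3 * r) - 1.
    by apply: le_ln1Dx; rewrite ltrBrDr addNr divr_gt0.
  rewrite addrC subrK ln_div ?posrE//.
  move=> /(ler_wpM2l (ltW (mulr_gt0 (ltr0n R 2) r0))).
  rewrite -[2%:R]/2.
  have -> : 2 * r * (s / (3 * r) - 1) = 2 / 3 * s - 2 * r by field; lra.
  by lra.
have bin : ('C(2 + d, d))%:R = d%:R ^+ 2 * ((1 + d%:R^-1) * (1 + 2 / d%:R)) / 2 :> R.
  have -> : 'C(2 + d, d) = 'C(2 + d, 2) by rewrite -bin_sub ?leq_addl// addnK.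
  have : ('C(2 + d, 2) * 2 = (2 + d) * (1 + d))%N.
    by have := bin_ffact (2 + d) 2; rewrite !ffactnS ffactn0 muln1.
  move=> /(congr1 (fun n => n%:R : R)); rewrite !natrM !natrD => h.
  by rewrite -[LHS](mulfK (_ : 2%:R != 0)) ?pnatr_eq0// h; field; rewrite gt_eqF.
have e3 : (1 + d%:R^-1) * (1 + 2 / d%:R) / 2 <= expR (4 / d%:R) * (expR 2 / 4) :> R.
  have d'0 : 0 < d%:R^-1 :> R by rewrite invr_gt0.
  have h1 := expR_ge1Dx (d%:R^-1 : R); have h2 := expR_ge1Dx (2 / d%:R : R).
  have h3 := expR_ge1Dx (2 : R).
  have h4 : expR (d%:R^-1) * expR (2 / d%:R) <= expR (4 / d%:R) :> R.
    by rewrite -expRD ler_expR; lra.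
  have h5 : (1 + d%:R^-1) * (1 + 2 / d%:R) <= expR (4 / d%:R) :> R.
    by apply: le_trans h4; rewrite ler_pM//; lra.
  by rewrite ler_pM//; try lra; rewrite mulr_ge0; lra.
have D2 : d%:R `^ (r - 2) = d%:R `^ r / d%:R ^+ 2 :> R.
  by rewrite -powR_mulrn ?(ltW D0)// powRB// (gt_eqF D0) implybT.
rewrite D2 bin expRB.
have Dr0 : 0 < d%:R `^ r :> R by rewrite powR_gt0.
set lhs := (X in X <= _).
apply: (@le_trans _ _ (8 * M * d%:R ^+ 2 * expR (- (2 / 3 * s)) *
    (expR (4 / d%:R) * (expR 2 / 4)))).
  have -> : lhs = M * d%:R ^+ 2 * (2 `^ (3 - s) * ((1 + d%:R^-1) * (1 + 2 / d%:R) / 2)).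
    by rewrite /lhs; ring.
  rewrite [leRHS](_ : _ = M * d%:R ^+ 2 * (8 * expR (- (2 / 3 * s)) *
    (expR (4 / d%:R) * (expR 2 / 4)))); last by ring.
  rewrite ler_wpM2l ?mulr_ge0 ?sqr_ge0// ler_pM ?powR_ge0//.
move: dr; rewrite expRN ler_pdivlMr ?expR_gt0// => dr.
set E2r := expR (2 * r) in dr *; have E2r0 : 0 < E2r by rewrite expR_gt0.
set P := _ `^ (2 * r) in dr *; set Q := d%:R `^ r in dr Dr0 *.
set E4 := expR (4 / d%:R); set E2 := expR 2.
have E20 : 0 < E2 by rewrite expR_gt0.
have -> : 8 * M * P * E4 / (4 * (E2r / E2) * (Q / d%:R ^+ 2)) =
   8 * M * d%:R ^+ 2 * (E4 * (E2 / 4)) * (P / E2r / Q).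
  by field; rewrite !gt_eqF.
rewrite mulrAC ler_wpM2l//.
  by rewrite !mulr_ge0 ?expR_ge0// sqr_ge0.
rewrite ler_pdivlMr// ler_pdivlMr//.
by lra.
Qed.

(** The integral of a nonnegative function is a supremum over the simple functions
below it, hence monotone on all functions.  This bounds the integral of the
error |f - f_(beta, d)|, in which the least minimizer is only known pointwise. *)
Lemma ge0_le_integral_nonmeasurable d (T : measurableType d) (R : realType)
    (nu : {measure set T -> \bar R}) (A : set T) (g h : T -> \bar R) :
  (forall x, A x -> 0 <= g x)%E -> (forall x, A x -> g x <= h x)%E ->
  (\int[nu]_(x in A) g x <= \int[nu]_(x in A) h x)%E.
Proof.
move=> g0 gh; have h0 x : A x -> (0 <= h x)%E by move=> Ax; exact: le_trans (g0 x Ax) (gh x Ax).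
rewrite !ge0_integralE//; apply: le_ereal_sup => _ [s sg <-]; exists s => // x.
by apply: le_trans (sg x) _; apply: lee_restrict.
Qed.

(** A one-point interval has empty interior. *)
Lemma lt_of_closure_interior (R : realType) (a b : R) : a <= b ->
  closure (interior `[a, b]%classic) = `[a, b]%classic -> a < b.
Proof.
move=> ab cl; rewrite lt_neqAle ab andbT; apply/eqP => eab; subst b.
have : `[a, a]%classic a by rewrite /= in_itv/= lexx.
rewrite -cl => /(_ setT (@filterT _ _ _))[z [+ _]].
move=> /nbhs_ballP[r /= r0 zr].
have inA y : ball z r y -> y = a.
  by move=> /zr/=; rewrite in_itv/= => /andP[h1 h2]; apply/eqP; rewrite eq_le h1 h2.
have za : z = a by apply: inA; exact: ballxx.
have : z + r / 2 = a.
  by apply: inA; rewrite /ball/= opprD addrA subrr add0r normrN gtr0_norm; lra.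
lra.
Qed.

Lemma le_dist_diameter_itv (R : realType) (c e y y' : R) :
  `[c, e]%classic y -> `[c, e]%classic y' ->
  `|y - y'| <= diameter (fun y y' : R => `|y - y'|) `[c, e]%classic.
Proof.
move=> Yy Yy'; apply: ub_le_sup; last by exists y => //; exists y'.
exists (e - c) => _ [u + [v + <-]]; rewrite /= !in_itv/= => /andP[u1 u2] /andP[v1 v2].
by rewrite ler_norml; apply/andP; split; lra.
Qed.

(** g is dominated by the step function lo + hi 1_S. *)
Lemma integral_le_off_small_set (R : realType) (a b : R) (g : R -> R) (S : set R)
    (lo hi lam : R) : a <= b ->
  measurable S -> (lebesgue_measure S <= lam%:E)%E -> 0 <= lo -> 0 <= hi ->
  (forall x, `[a, b]%classic x -> 0 <= g x <= hi) ->
  (forall x, `[a, b]%classic x -> ~ S x -> g x <= lo) ->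
  (\int[lebesgue_measure]_(x in `[a, b]%classic) (g x)%:E
    <= ((b - a) * lo + hi * lam)%:E)%E.
Proof.
move=> ab mS lamS lo0 hi0 ghi glo; set X := `[a, b]%classic.
have mX : measurable X by exact: measurable_itv.
apply: (@le_trans _ _ (\int[lebesgue_measure]_(x in X) (lo%:E + hi%:E * (\1_S x)%:E))%E).
  apply: ge0_le_integral_nonmeasurable => x Xx; have /andP[g0 gh] := ghi x Xx.
    by rewrite lee_fin.
  rewrite indicE; have [xS|xS] := boolP (x \in S).
    by rewrite -EFinM -EFinD lee_fin mulr1 (le_trans gh)// lerDr.
  rewrite -EFinM -EFinD lee_fin mulr0 addr0 glo//.
  by move=> Sx; rewrite mem_set in xS.
have m1 : measurable_fun X (fun x => (\1_S x)%:E : \bar R).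
  by apply/measurable_EFinP; exact: measurable_indic.
rewrite ge0_integralD//; last 2 first.
- by move=> x _; rewrite mule_ge0 ?lee_fin.
- exact: measurable_funeM.
rewrite [X in (X + _)%E](integral_cst lebesgue_measure mX lo%:E).
rewrite ge0_integralZl//.
rewrite integral_indic//.
have lX : lebesgue_measure X = (b - a)%:E.
  rewrite lebesgue_measure_itv/= lte_fin; have [_|ba] := ltP a b; first by rewrite -EFinD.
  suff -> : a = b by rewrite subrr.
  by apply/eqP; rewrite eq_le ab.
apply: (@le_trans _ _ ((lo * (b - a))%:E + (hi * lam)%:E)%E); last first.
  by rewrite -EFinD lee_fin mulrC.
rewrite [X in (_ * X + _)%E]lX leeD2l// EFinM lee_wpmul2l ?lee_fin//.
by apply: le_trans lamS; apply: le_measure; rewrite ?inE//; exact: measurableI.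
Qed.

Theorem theorem2 (R : realType) (a b c e : R)
    (hab : a <= b) (hX : closure (interior `[a, b]%classic) = `[a, b]%classic) (hce : c <= e)
    (f : R -> R) (hfY : f @` `[a, b]%classic `<=` `[c, e]%classic)
    (hf : measurable_fun `[a, b]%classic f)
    (hV : (total_variation a b f < +oo)%E)
    (mu0 : {measure set (plane R) -> \bar R})
    (hac : mu0 `<< (@lebesgue_measure R \x @lebesgue_measure R)%E)
    (hcpt : compact (measure_support mu0))
    (r : R) (hr : 2 < r) (d : nat) (hd : (1 < d)%N)
    (B : 'I_('C(2 + d, d)) -> mpoly 2 R) (hB : orthonormal_polys mu0 B) :
  let mu : {measure set (plane R) -> \bar R} :=
    graph_measure (measurable_itv `[a, b]) hf in
  let m : R := fine (mu setT) in
  let m0 : R := fine (mu0 setT) in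
  let V : R := fine (total_variation a b f) in
  let volX : R := fine (lebesgue_measure `[a, b]%classic) in
  let diamY : R := diameter (fun y y' : R => `|y - y'|) `[c, e]%classic in
  let delta0 : R :=
    diameter euclidean_dist (measure_support (measure_add mu mu0)) in
  let D : R := d%:R in
  let beta : R := 2 `^ (3 - Num.sqrt D) in
  (\int[lebesgue_measure]_(x in `[a, b]%classic)
      `|f x - cd_approx mu B beta `[c, e]%classic x|%:E <=
   (volX * (2 * delta0 / (Num.sqrt D - 1) + D `^ (- (1 / 4)))
    + diamY *
      (8 * (m + m0) * (3 * r) `^ (2 * r) * expR (4 / D)
         / (4 * expR (2 * r - 2) * D `^ (r - 2))
       + 4 * D `^ (1 / 4) * V * delta0 / (Num.sqrt D - 1)))%:E)%E.
Proof.
(* The local definitions of the statement lie inside a boolean, so they are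
   named anew instead of being introduced. *)
pose mu : {measure set (plane R) -> \bar R} :=
  graph_measure (measurable_itv `[a, b]) hf.
pose m0 := fine (mu0 setT).
pose V := fine (total_variation a b f).
pose diamY := diameter (fun y y' : R => `|y - y'|) `[c, e]%classic.
pose delta0 := diameter euclidean_dist (measure_support (measure_add mu mu0)).
pose D : R := d%:R.
pose beta : R := 2 `^ (3 - Num.sqrt D).
have ab : a < b by exact: lt_of_closure_interior hab hX.
have volXE : fine (lebesgue_measure `[a, b]%classic) = b - a.
  by rewrite lebesgue_measure_itv/= lte_fin ab -EFinD.
have mE : fine (mu setT) = b - a by rewrite /mu (graph_measureT ab).
pose s := Num.sqrt D; have s1 : 1 < s by rewrite -(@sqrtr1 R) ltr_sqrt ?ltr1n// ltr0n ltnW.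
have delta0_gt0 : 0 < delta0 by exact: (diameter_gt0 ab hfY hf hcpt).
have V0 : 0 <= V by rewrite fine_ge0// total_variation_ge0.
have D0 : 0 < D by rewrite ltr0n ltnW.
pose eps := D `^ (- (1 / 4)); have eps0 : 0 < eps by rewrite powR_gt0.
have epsV : D `^ (1 / 4) = eps^-1 by rewrite /eps powRN invrK.
pose del := delta0 / (s - 1).
have del0 : 0 < del by rewrite divr_gt0// subr_gt0.
(* The factor 4 / 3 turns the measure 3 V Del / eps of the set of large
   oscillation into 4 V del / eps, and the ratio Del / (Del + delta0) into
   4 / (3 s + 1). *)
pose Del := 4 / 3 * del.
have Del0 : 0 < Del by rewrite mulr_gt0//; lra.
have sDel : 4 / (3 * s + 1) <= Del / (Del + delta0).
  rewrite le_eqVlt; apply/orP; left; apply/eqP; rewrite /Del /del; field.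
  by rewrite !gt_eqF//; try lra; nra.
have [B2 mB2 [lB2 oscB2]] := small_oscillation_off_small_set hab hV Del0 eps0.
pose L := beta * (b - a + m0).
pose B1 := [set x | `[a, b]%classic x /\ L^-1 <= cd_poly mu B beta (x, f x)].
have mB1 : measurable B1 by exact: (measurable_graph_exceedance hf mu0 B).
have lB1 := graph_markov ab hfY hf hcpt B.
have diamY0 : 0 <= diamY.
  have Yc : `[c, e]%classic c by rewrite /= in_itv/= lexx.
  by apply: le_trans (le_dist_diameter_itv Yc Yc).
have fY x : `[a, b]%classic x -> `[c, e]%classic (f x) by move=> Xx; apply: hfY; exists x.
have m00 : 0 <= m0 by exact: fine_ge0.
have L0 : 0 < L by rewrite mulr_gt0 ?powR_gt0// ltr_wpDr// subr_gt0.
apply: (@le_trans _ _ ((b - a) * (Del + eps) +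
    diamY * (L * 'C(2 + d, d)%:R + 3 * V * Del / eps))%:E).
  apply: (@integral_le_off_small_set _ _ _ _ (B1 `|` B2)) => //.
  - exact: measurableU.
  - have lU := measureU2 lebesgue_measure mB1 mB2.
    by apply: (le_trans lU); rewrite EFinD leeD.
  - by rewrite addr_ge0// ltW.
  - move=> x Xx; rewrite normr_ge0/=; apply: le_dist_diameter_itv; first exact: fY.
    by have [] := cd_approx_argmin hf B x hce.
  - move=> x Xx nB.
    have [Yy ymin] := cd_approx_argmin hf B x hce.
    set y := cd_approx _ _ _ _ _ in Yy ymin *.
    have qsmall : cd_poly mu B beta (x, y) < L^-1.
      rewrite ltNge; apply/negP => qL; apply: nB; left; split=> //.
      by apply: le_trans qL _; exact: ymin (fY x Xx).
    have [x' x'ab dx'] : exists2 x', x' \in `[a, b] & euclidean_dist (x, y) (x', f x') < Del.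
      apply: contrapT => far; move: qsmall; rewrite ltNge => /negP; apply.
      have low := @cd_poly_lower_bound_off_graph R a b c e ab f hfY hf mu0 hcpt d hd B hB
        (x, y) Del Del0 sDel.
      apply: low => x' x'ab.
      by rewrite leNgt; apply/negP => h; apply: far; exists x'.
    have h1 := euclidean_dist_ge1 (x, y) (x', f x').
    have h2 := euclidean_dist_ge2 (x, y) (x', f x').
    have osc : `|f x - f x'| <= eps.
      apply: oscB2 => //; first by move=> B2x; apply: nB; right.
      exact: le_trans h1 (ltW dx').
    rewrite /= distrC in h2.
    have tri := ler_normD (f x - f x') (f x' - y); rewrite subrKA in tri.
    apply: le_trans tri _; rewrite addrC lerD//.
    exact: le_trans h2 (ltW dx').
rewrite lee_fin volXE [fine (_ setT)]mE -/D -/s -/eps epsV -/V -/diamY -/m0 -/delta0.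
have rate := @markov_rate R r d (b - a + m0) _ _ _.
apply: lerD.
  rewrite (_ : 2 * delta0 / (s - 1) = 2 * del); last by rewrite /del mulrA.
  by rewrite ler_wpM2l ?subr_ge0// lerD2r /Del; lra.
rewrite ler_wpM2l//; apply: lerD.
  rewrite /L; apply: rate.
  - lra.
  - exact: ltnW.
  - by rewrite addr_ge0// subr_ge0.
rewrite le_eqVlt; apply/orP; left; apply/eqP; rewrite /Del /del; field.
by rewrite !gt_eqF//; lra.
Qed.
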